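(* Let $G$ be a finite group, $k$ a field of characteristic $2$, $B$ a block of the group algebra $kG$, and $D$ a defect group of $B$. Then the Loewy length of $B$ is strictly greater than the $2$-rank of $D$: $$\operatorname{ll}(B)>2\text{-}\mathrm{rank}(D).$$
   Context: For an artinian ring $A$ with Jacobson radical $J(A)$, the Loewy length $\operatorname{ll}(A)$ is the smallest integer $i$ such that $J(A)^i=0$. The $p$-rank of a finite group is the largest $r$ such that the group contains an elementary abelian $p$-subgroup of order $p^r$. A defect group of a block $B$ of $kG$ is a (smallest) subgroup $D$ of $G$ such that the identity functor of $B\text{-mod}$ is a direct summand of $\operatorname{Ind}_D^G\operatorname{Res}_D^G$. *)

(* Defs.v *)
From HB Require Import structures.
From mathcomp Require Import all_boot all_order all_algebra.
From mathcomp Require Import all_fingroup all_solvable.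
From mathcomp Require Import boolp classical_sets.

Set Implicit Arguments.
Unset Strict Implicit.
Unset Printing Implicit Defensive.

Import GRing.Theory.
Local Open Scope ring_scope.

Section Loewy.
Context {A : pzRingType}.

Definition left_ideal (I : set A) : Prop :=
  [/\ I 0, forall x y, I x -> I y -> I (x + y) & forall a x, I x -> I (a * x)].

Definition maximal_left_ideal (I : set A) : Prop :=
  [/\ left_ideal I, ~ I 1 &
      forall J, left_ideal J -> ~ J 1 -> (I `<=` J)%classic -> (J `<=` I)%classic].

Definition jacobson : set A :=
  fun x => forall I, maximal_left_ideal I -> I x.

Definition ideal_mul (I J : set A) : set A :=
  fun x => exists n (a b : 'I_n -> A),
    [/\ forall i, I (a i), forall i, J (b i) & x = \sum_i a i * b i].

Fixpoint ideal_exp (I : set A) (n : nat) : set A :=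
  if n is n'.+1 then ideal_mul I (ideal_exp I n') else setT.

End Loewy.

(* The value is 0 if the Jacobson radical is not nilpotent, which does not
   happen for artinian rings. *)
Definition loewy_length (A : pzRingType) : nat :=
  let P (i : nat) := `[< ideal_exp (@jacobson A) i = [set 0]%classic >] in
  if pselect (exists i, P i) is left ex then ex_minn ex else 0%N.

Definition group_algebra (k : fieldType) (gT : finGroupType) := {ffun gT -> k}.

Section GroupAlgebra.
Variables (k : fieldType) (gT : finGroupType).
Local Notation kG := (group_algebra k gT).

HB.instance Definition _ := GRing.Lmodule.copy kG {ffun gT -> k^o}.

Definition galg_elt (x : gT) : kG := [ffun y => (y == x)%:R].

Definition galg_mul (a b : kG) : kG :=
  [ffun x => \sum_y a y * b (y^-1 * x)%g].

Let g_mulA : associative galg_mul.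
Proof.
move=> a b c; apply/ffunP=> x; rewrite !ffunE.
under eq_bigr do rewrite ffunE mulr_sumr.
under [RHS]eq_bigr do rewrite ffunE mulr_suml.
rewrite [RHS]exchange_big; apply: eq_bigr => y _.
rewrite (reindex_inj (mulgI y^-1)%g); apply: eq_bigr => z _ /=.
by rewrite mulrA invMg invgK -!mulgA mulKVg.
Qed.

Let g_mul1l : left_id (galg_elt 1) galg_mul.
Proof.
move=> a; apply/ffunP=> x; rewrite ffunE (bigD1 1%g) //= !ffunE eqxx mul1r.
rewrite invg1 mul1g big1 ?addr0 // => y /negPf y1.
by rewrite ffunE y1 mul0r.
Qed.

Let g_mul1r : right_id (galg_elt 1) galg_mul.
Proof.
move=> a; apply/ffunP=> x; rewrite ffunE (bigD1 x) //= !ffunE mulVg eqxx mulr1.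
rewrite big1 ?addr0 // => y /negPf yx.
by rewrite ffunE -eq_mulVg1 yx mulr0.
Qed.

Let g_mulDl : left_distributive galg_mul +%R.
Proof.
move=> a b c; apply/ffunP=> x; rewrite !ffunE -big_split.
by apply: eq_bigr => y _; rewrite ffunE mulrDl.
Qed.

Let g_mulDr : right_distributive galg_mul +%R.
Proof.
move=> a b c; apply/ffunP=> x; rewrite !ffunE -big_split.
by apply: eq_bigr => y _; rewrite ffunE mulrDr.
Qed.

Let g_one_neq0 : galg_elt 1 != 0.
Proof.
by apply/eqP=> /ffunP/(_ 1%g); rewrite !ffunE eqxx => /eqP; rewrite oner_eq0.
Qed.

HB.instance Definition _ := GRing.Zmodule_isNzRing.Build kG
  g_mulA g_mul1l g_mul1r g_mulDl g_mulDr g_one_neq0.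

Let g_scaleAl (c : k) (a b : kG) : c *: (a * b) = (c *: a) * b.
Proof.
apply/ffunP=> x; rewrite !ffunE scaler_sumr.
by apply: eq_bigr => y _; rewrite ffunE; apply: mulrA.
Qed.

HB.instance Definition _ := GRing.Lmodule_isLalgebra.Build k kG g_scaleAl.

Let g_scaleAr (c : k) (a b : kG) : c *: (a * b) = a * (c *: b).
Proof.
apply/ffunP=> x; rewrite !ffunE scaler_sumr.
by apply: eq_bigr => y _; rewrite ffunE; apply: mulrCA.
Qed.

HB.instance Definition _ := GRing.Lalgebra_isAlgebra.Build k kG g_scaleAr.

Lemma galg_mulE (a b : kG) x : (a * b) x = \sum_y a y * b (y^-1 * x)%g.
Proof. by rewrite ffunE. Qed.

Lemma galg_eltM x y : galg_elt (x * y) = galg_elt x * galg_elt y.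
Proof.
apply/ffunP=> z; rewrite galg_mulE (bigD1 x) //= !ffunE eqxx mul1r.
rewrite big1 ?addr0 => [|w /negPf wx]; last by rewrite ffunE wx mul0r.
by rewrite -(inj_eq (mulgI x) (x^-1 * z)%g) mulKVg.
Qed.

Lemma galg_elt1 : galg_elt 1 = 1. Proof. by []. Qed.

Lemma galg_sumE (a : kG) : a = \sum_x a x *: galg_elt x.
Proof.
apply/ffunP=> y; rewrite sum_ffunE (bigD1 y) //= !ffunE eqxx.
rewrite big1 ?addr0 => [|x /negPf xy]; first by rewrite /GRing.scale /= mulr1.
by rewrite !ffunE eq_sym xy scaler0.
Qed.

End GroupAlgebra.

Definition central {A : pzRingType} (e : A) : Prop := forall x, e * x = x * e.

Definition central_idempotent {A : pzRingType} (e : A) : Prop :=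
  e * e = e /\ central e.

Definition block_idempotent {A : pzRingType} (e : A) : Prop :=
  [/\ central_idempotent e, e != 0 &
      forall f g, central_idempotent f -> central_idempotent g ->
        f * g = 0 -> e = f + g -> f = 0 \/ g = 0].

(* A block kGe, given by its primitive central idempotent e. *)
Record block (k : fieldType) (gT : finGroupType) := Block {
  block_idem : group_algebra k gT;
  block_idemP : block_idempotent block_idem
}.

Section BlockAlgebra.
Variables (k : fieldType) (gT : finGroupType) (B : block k gT).
Local Notation kG := (group_algebra k gT).
Local Notation e := (block_idem B).

Definition in_block : {pred kG} := fun x => x * e == x.

Record block_algebra := BlockElt {
  block_val : kG;
  _ : block_val \in in_block
}.

HB.instance Definition _ := [isSub for block_val].
HB.instance Definition _ := [Choice of block_algebra by <:].

Let in_block_submod : submod_closed in_block.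
Proof.
split=> [|c x y /eqP xe /eqP ye]; first by rewrite unfold_in mul0r.
by rewrite unfold_in mulrDl -scalerAl xe ye.
Qed.

HB.instance Definition _ :=
  GRing.isSubmodClosed.Build k kG in_block in_block_submod.
HB.instance Definition _ := [SubChoice_isSubLmodule of block_algebra by <:].

Let block1_subproof : e \in in_block.
Proof. by case: (block_idemP B) => -[ee _] _ _; rewrite unfold_in ee. Qed.

Let blockM_subproof (x y : block_algebra) : \val x * \val y \in in_block.
Proof. by rewrite unfold_in -mulrA (eqP (valP y)). Qed.

Definition block_one := BlockElt block1_subproof.
Definition block_mul x y := BlockElt (blockM_subproof x y).

Let b_mulA : associative block_mul.
Proof. by move=> x y z; apply/val_inj; rewrite /= mulrA. Qed.

Let b_mul1l : left_id block_one block_mul.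
Proof.
move=> x; apply/val_inj => /=; case: (block_idemP B) => -[_ eC] _ _.
by rewrite eC (eqP (valP x)).
Qed.

Let b_mul1r : right_id block_one block_mul.
Proof. by move=> x; apply/val_inj; rewrite /= (eqP (valP x)). Qed.

Let b_mulDl : left_distributive block_mul +%R.
Proof. by move=> x y z; apply/val_inj; rewrite /= mulrDl. Qed.

Let b_mulDr : right_distributive block_mul +%R.
Proof. by move=> x y z; apply/val_inj; rewrite /= mulrDr. Qed.

Let b_one_neq0 : block_one != 0.
Proof. by rewrite -val_eqE; case: (block_idemP B). Qed.

HB.instance Definition _ := GRing.Zmodule_isNzRing.Build block_algebra
  b_mulA b_mul1l b_mul1r b_mulDl b_mulDr b_one_neq0.

Let b_scaleAl (c : k) (x y : block_algebra) : c *: (x * y) = (c *: x) * y.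
Proof. by apply/val_inj; rewrite /= scalerAl. Qed.

HB.instance Definition _ := GRing.Lmodule_isLalgebra.Build k block_algebra b_scaleAl.

Let b_scaleAr (c : k) (x y : block_algebra) : c *: (x * y) = x * (c *: y).
Proof. by apply/val_inj; rewrite /= scalerAr. Qed.

HB.instance Definition _ := GRing.Lalgebra_isAlgebra.Build k block_algebra b_scaleAr.

End BlockAlgebra.

Definition resmod (k : fieldType) (gT : finGroupType) (D : {group gT})
  (M : lmodType (group_algebra k gT)) : Type := M.

Section Res.
Variables (k : fieldType) (gT : finGroupType) (D : {group gT}).
Local Notation kG := (group_algebra k gT).
Local Notation kD := (group_algebra k (subg_of D)).

Definition galg_incl (a : kD) : kG := \sum_d a d *: galg_elt k (val d).

Lemma galg_incl_elt d : galg_incl (galg_elt k d) = galg_elt k (val d).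
Proof.
rewrite /galg_incl (bigD1 d) //= ffunE eqxx scale1r big1 ?addr0 // => c cd.
by rewrite ffunE (negPf cd) scale0r.
Qed.

Let incl_linear : linear galg_incl.
Proof.
move=> c a b; rewrite /galg_incl scaler_sumr -big_split.
by apply: eq_bigr => d _; rewrite !ffunE scalerDl scalerA.
Qed.

HB.instance Definition _ := GRing.isLinear.Build k kD kG _ galg_incl incl_linear.

Let incl_monoid : monoid_morphism galg_incl.
Proof.
split=> [|a b]; first by rewrite -!galg_elt1 galg_incl_elt.
rewrite [a]galg_sumE [b]galg_sumE !linear_sum !mulr_suml linear_sum.
apply: eq_bigr => x _; rewrite !mulr_sumr linear_sum; apply: eq_bigr => y _.
rewrite !linearZ /= -!scalerAl -!scalerAr !linearZ /= -galg_eltM !galg_incl_elt.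
by rewrite -galg_eltM !scalerA mulrC.
Qed.

HB.instance Definition _ :=
  GRing.isMonoidMorphism.Build kD kG galg_incl incl_monoid.

Section ResModule.
Variable M : lmodType kG.
HB.instance Definition _ := GRing.Zmodule.on (resmod D M).

Definition res_scale (a : kD) (m : resmod D M) : resmod D M :=
  galg_incl a *: (m : M).

Let scaleA a b m : res_scale a (res_scale b m) = res_scale (a * b) m.
Proof. by rewrite /res_scale scalerA rmorphM. Qed.
Let scale1 : left_id 1 res_scale.
Proof. by move=> m; rewrite /res_scale rmorph1 scale1r. Qed.
Let scaleDr : right_distributive res_scale +%R.
Proof. by move=> a m n; rewrite /res_scale scalerDr. Qed.
Let scaleDl m : {morph res_scale^~ m : a b / a + b}.
Proof. by move=> a b; rewrite /res_scale raddfD scalerDl. Qed.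

HB.instance Definition _ := GRing.Zmodule_isLmodule.Build kD (resmod D M)
  scaleA scale1 scaleDr scaleDl.

Lemma res_scaleE a (m : resmod D M) : a *: m = galg_incl a *: (m : M).
Proof. by []. Qed.

End ResModule.

Section ResMap.
Variables (M M' : lmodType kG) (phi : {linear M -> M'}).

Definition res_map (m : resmod D M) : resmod D M' := phi m.

Let res_map_linear : linear res_map.
Proof. by move=> a m n; rewrite /res_map [phi _]linearP. Qed.

HB.instance Definition _ :=
  GRing.isLinear.Build kD (resmod D M) (resmod D M') _ res_map res_map_linear.
End ResMap.

End Res.

Arguments res_map {k gT} D {M M'} phi m.

(* The induced module, i.e. the tensor product of kG and N over kD, realised
   as the space of functions f : G -> N with f (g d) = d^-1 (f g), on which x
   in G acts by (x f) g = f (x^-1 g): the tensor of g and n corresponds to the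
   function supported on gD which maps gd to d^-1 n.  ind_universal shows that
   it is left adjoint to restriction. *)
Section Ind.
Variables (k : fieldType) (gT : finGroupType) (D : {group gT}).
Local Notation kG := (group_algebra k gT).
Local Notation kD := (group_algebra k (subg_of D)).

Section IndModule.
Variable N : lmodType kD.

Definition is_equivariant : {pred {ffun gT -> N}} :=
  fun f => [forall g, forall d : subg_of D,
    f (g * val d)%g == galg_elt k d^-1%g *: f g].

Record indmod := IndElt {
  ind_fun : {ffun gT -> N};
  _ : ind_fun \in is_equivariant
}.

HB.instance Definition _ := [isSub for ind_fun].
HB.instance Definition _ := [Choice of indmod by <:].

Lemma is_equivariantP (f : {ffun gT -> N}) :
  reflect (forall g (d : subg_of D), f (g * val d)%g = galg_elt k d^-1%g *: f g)
          (f \in is_equivariant).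
Proof.
by apply: (iffP forallP) => [H g d|H g];
  [have /forallP/(_ d)/eqP := H g | apply/forallP=> d; apply/eqP].
Qed.

Let equivariant_zmod : zmod_closed is_equivariant.
Proof.
split=> [|f h /is_equivariantP fE /is_equivariantP hE];
  apply/is_equivariantP=> g d; rewrite !ffunE ?scaler0 //.
by rewrite fE hE scalerBr.
Qed.

HB.instance Definition _ :=
  GRing.isZmodClosed.Build {ffun gT -> N} is_equivariant equivariant_zmod.
HB.instance Definition _ := [SubChoice_isSubZmodule of indmod by <:].

Definition ind_scale_fun (a : kG) (f : {ffun gT -> N}) : {ffun gT -> N} :=
  [ffun g => \sum_x ((a x)%:A : kD) *: f (x^-1 * g)%g].

Let ind_scale_subproof a (f : indmod) :
  ind_scale_fun a (\val f) \in is_equivariant.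
Proof.
apply/is_equivariantP=> g d; rewrite !ffunE scaler_sumr.
apply: eq_bigr => x _; rewrite mulgA (is_equivariantP _ (valP f)) !scalerA.
by rewrite -scalerAl mul1r -scalerAr mulr1.
Qed.

Definition ind_scale a f : indmod := IndElt (ind_scale_subproof a f).

Let scaleA a b f : ind_scale a (ind_scale b f) = ind_scale (a * b) f.
Proof.
apply/val_inj/ffunP=> g; rewrite !ffunE.
under eq_bigr do rewrite ffunE scaler_sumr.
under [RHS]eq_bigr do rewrite ffunE scaler_suml scaler_suml.
rewrite [RHS]exchange_big; apply: eq_bigr => x _.
rewrite [RHS](reindex_inj (mulgI x)); apply: eq_bigr => y _ /=.
by rewrite mulKg invMg mulgA scalerA -scalerAl mul1r scalerA.
Qed.

Let scale1 : left_id 1 ind_scale.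
Proof.
move=> f; apply/val_inj/ffunP=> g; rewrite ffunE (bigD1 1%g) //= ffunE eqxx.
rewrite !scale1r invg1 mul1g big1 ?addr0 // => x /negPf x1.
by rewrite ffunE x1 !scale0r.
Qed.

Let scaleDr : right_distributive ind_scale +%R.
Proof.
move=> a f h; apply/val_inj/ffunP=> g; rewrite !ffunE -big_split.
by apply: eq_bigr => x _; rewrite !ffunE scalerDr.
Qed.

Let scaleDl f : {morph ind_scale^~ f : a b / a + b}.
Proof.
move=> a b; apply/val_inj/ffunP=> g; rewrite !ffunE -big_split.
by apply: eq_bigr => x _; rewrite !ffunE scalerDl scalerDl.
Qed.

HB.instance Definition _ := GRing.Zmodule_isLmodule.Build kG indmod
  scaleA scale1 scaleDr scaleDl.

End IndModule.

Section IndMap.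
Variables (N N' : lmodType kD) (phi : {linear N -> N'}).

Let ind_map_subproof (f : indmod N) :
  [ffun g => phi (\val f g)] \in @is_equivariant N'.
Proof.
apply/is_equivariantP=> g d.
by rewrite !ffunE (is_equivariantP _ (valP f)) linearZ.
Qed.

Definition ind_map (f : indmod N) : indmod N' := IndElt (ind_map_subproof f).

Let ind_map_linear : linear ind_map.
Proof.
move=> a f h; apply/val_inj/ffunP=> g; rewrite !ffunE linearD linear_sum.
by congr (_ + _); apply: eq_bigr => x _; rewrite linearZ ffunE.
Qed.

HB.instance Definition _ :=
  GRing.isLinear.Build kG (indmod N) (indmod N') _ ind_map ind_map_linear.
End IndMap.

Section IndUniversal.
Variables (N : lmodType kD).

Definition ind_unit_fun (n : N) : {ffun gT -> N} :=
  [ffun g => if g \in D then galg_elt k (subg D g)^-1%g *: n else 0].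

Let ind_unit_subproof n : ind_unit_fun n \in @is_equivariant N.
Proof.
apply/is_equivariantP=> g d; rewrite !ffunE groupMr ?subgP //.
case: ifP => [gD|_]; last by rewrite scaler0.
rewrite scalerA -galg_eltM -invMg; congr (galg_elt k _^-1%g *: n).
by apply/val_inj; rewrite /= !subgK ?groupMr ?subgP.
Qed.

Definition ind_unit n : resmod D (indmod N) := IndElt (ind_unit_subproof n).

Lemma ind_scale_elt x (f : indmod N) g :
  \val (galg_elt k x *: f) g = \val f (x^-1 * g)%g.
Proof.
rewrite ffunE (bigD1 x) //= ffunE eqxx !scale1r big1 ?addr0 // => y /negPf yx.
by rewrite ffunE yx !scale0r.
Qed.

Lemma ind_scaleZ (c : k) a (f : indmod N) g :
  \val ((c *: a) *: f) g = (c%:A : kD) *: \val (a *: f) g.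
Proof.
rewrite !ffunE scaler_sumr; apply: eq_bigr => x _.
by rewrite !ffunE !scalerA -scalerAl mul1r scalerA.
Qed.

Let val_sum I (r : seq I) P (F : I -> indmod N) g :
  \val (\sum_(i <- r | P i) F i) g = \sum_(i <- r | P i) \val (F i) g.
Proof. by rewrite raddf_sum sum_ffunE. Qed.

Let ind_unitZ a n : ind_unit (a *: n) = galg_incl a *: (ind_unit n : indmod N).
Proof.
apply/val_inj/ffunP=> g; rewrite /galg_incl scaler_suml val_sum.
under [RHS]eq_bigr do rewrite ind_scaleZ ind_scale_elt /= ffunE.
rewrite !ffunE; case: ifP => gD; last first.
  rewrite big1 // => d _.
  by rewrite groupMl ?groupV ?subgP // gD scaler0.
rewrite [in LHS](galg_sumE a) scaler_suml scaler_sumr; apply: eq_bigr => d _.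
rewrite groupMl ?groupV ?subgP // gD !scalerA -scalerAl mul1r -scalerAr.
rewrite -galg_eltM; congr (_ *: galg_elt k _ *: n).
by apply/val_inj; rewrite /= !subgK ?groupM ?groupV ?subgP // invMg invgK.
Qed.

Let ind_unit_linear : linear ind_unit.
Proof.
move=> a n n'; rewrite res_scaleE -ind_unitZ.
apply/val_inj/ffunP=> g; rewrite !ffunE.
by case: ifP => _; rewrite ?addr0 // scalerDr.
Qed.

HB.instance Definition _ :=
  GRing.isLinear.Build kD N (resmod D (indmod N)) _ ind_unit ind_unit_linear.

Variables (M : lmodType kG) (phi : {linear N -> resmod D M}).

Let h (f : indmod N) g : M := galg_elt k g *: (phi (\val f g) : M).
Let G := [set: gT]%G.

Let repr_coset X : X \in lcosets D G -> X = (repr X *: D)%g.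
Proof.
by case/lcosetsP=> x _ ->; apply/esym/lcoset_eqP; apply: mem_repr (lcoset_refl D x).
Qed.

Let hM f g d : d \in D -> h f (g * d)%g = h f g.
Proof.
move=> dD; have {d dD} [d ->] : exists d' : subg_of D, d = val d'.
  by exists (subg D d); rewrite /= subgK.
rewrite /h (is_equivariantP _ (valP f)) linearZ /= res_scaleE galg_incl_elt.
by rewrite scalerA -galg_eltM /= mulgK.
Qed.

Let h_coset f x y : (x *: D = y *: D)%g -> h f x = h f y.
Proof.
move/lcoset_eqP; rewrite mem_lcoset => yx.
by rewrite -(mulKVg y x) hM.
Qed.

Definition ind_ext (f : indmod N) : M :=
  \sum_(X in lcosets D G) h f (repr X).

Let ind_ext_translate x f :
  \sum_(X in lcosets D G) h f (x^-1 * repr X)%g = ind_ext f.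
Proof.
rewrite /ind_ext [RHS](reindex_inj (@lcoset_inj _ x^-1%g)) /=.
apply: eq_big => [X | X XD].
  apply/lcosetsP/lcosetsP=> [[y _ ->] | [y _ Xy]].
    by exists (x^-1 * y)%g; rewrite ?inE ?lcosetM.
  by exists (x * y)%g; rewrite ?inE // lcosetM -Xy -lcosetM mulgV lcoset1.
apply: h_coset; rewrite lcosetM -(repr_coset XD) -repr_coset //.
by apply/lcosetsP; exists (x^-1 * repr X)%g; rewrite ?inE // lcosetM -repr_coset.
Qed.

Let ind_ext_linear : linear ind_ext.
Proof.
move=> a f f'; rewrite /ind_ext.
have -> : a *: ind_ext f =
    \sum_(X in lcosets D G) \sum_x (a x *: galg_elt k (repr X)) *:
      (phi (\val f (x^-1 * repr X)%g) : M).
  rewrite exchange_big /= [in LHS](galg_sumE a) scaler_suml.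
  apply: eq_bigr => x _; rewrite -(ind_ext_translate x) scaler_sumr.
  apply: eq_bigr => X _; rewrite /h scalerA -scalerAl -galg_eltM.
  by rewrite mulKVg.
rewrite -big_split; apply: eq_bigr => X _ /=.
rewrite /h !ffunE linearD scalerDr; congr (_ + _).
rewrite linear_sum scaler_sumr; apply: eq_bigr => x _.
by rewrite linearZ /= res_scaleE linearZ rmorph1 scalerA -scalerAr mulr1.
Qed.

HB.instance Definition _ :=
  GRing.isLinear.Build kG (indmod N) M _ ind_ext ind_ext_linear.

Let ind_ext_unit n : ind_ext (ind_unit n) = phi n.
Proof.
have DD : gval D \in lcosets D G.
  by apply/lcosetsP; exists 1%g; rewrite ?inE ?lcoset1.
rewrite /ind_ext (bigD1 (gval D)) //= big1 ?addr0 => [|X /andP[XD neX]].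
  rewrite (@h_coset _ _ 1%g) -?repr_coset ?lcoset1 // /h ffunE group1.
  rewrite (_ : (subg D 1)^-1 = 1)%g; last first.
    by apply/val_inj; rewrite /= subgK // invg1.
  by rewrite !galg_elt1 !scale1r.
rewrite /h ffunE; case: ifP => [rD|_]; last by rewrite linear0 scaler0.
by case/eqP: neX; rewrite [X]repr_coset // lcoset_id.
Qed.

Let ind_sumE (f : indmod N) :
  f = \sum_(X in lcosets D G) galg_elt k (repr X) *:
        (ind_unit (\val f (repr X)) : indmod N).
Proof.
apply/val_inj/ffunP=> g; rewrite val_sum.
under eq_bigr do rewrite ind_scale_elt /= ffunE.
have gD : (g *: D)%g \in lcosets D G by apply/lcosetsP; exists g; rewrite ?inE.
rewrite (bigD1 (g *: D)%g) //= big1 ?addr0 => [|X /andP[XD neX]].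
  have rD : ((repr (g *: D))^-1 * g)%g \in D.
    by rewrite -mem_lcoset -repr_coset // lcoset_refl.
  rewrite rD -(is_equivariantP _ (valP f)); congr (\val f _).
  by rewrite /= subgK // mulKVg.
case: ifP => // rD; case/eqP: neX.
by rewrite [X]repr_coset //; apply/esym/lcoset_eqP; rewrite mem_lcoset.
Qed.

Lemma ind_universal :
  exists psi : {linear indmod N -> M},
    (forall n, psi (ind_unit n) = phi n) /\
    forall psi' : {linear indmod N -> M},
      (forall n, psi' (ind_unit n) = phi n) -> psi' =1 psi.
Proof.
exists ind_ext; split=> [n|psi' psi'E f]; first exact: ind_ext_unit.
rewrite [f]ind_sumE linear_sum linear_sum; apply: eq_bigr => X _.
by rewrite !linearZ /= psi'E ind_ext_unit.
Qed.

End IndUniversal.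

End Ind.

Definition finitely_generated (A : pzRingType) (M : lmodType A) : Prop :=
  exists n (s : 'I_n -> M), forall m, exists c : 'I_n -> A,
    m = \sum_i c i *: s i.

(* Objects of B-mod, seen as kG-modules on which the unit of B acts as the
   identity; the morphisms of B-mod are the kG-linear maps. *)
Record block_mod (k : fieldType) (gT : finGroupType) (B : block k gT) := BlockMod {
  block_mod_sort :> lmodType (group_algebra k gT);
  block_mod_fg : finitely_generated block_mod_sort;
  block_mod_unit : forall m : block_mod_sort, block_idem B *: m = m
}.

Section Defect.
Variables (k : fieldType) (gT : finGroupType) (B : block k gT).
Implicit Type D : {group gT}.

(* The identity functor of B-mod is a direct summand of Ind_D^G Res_D^G:
   there are natural transformations eta from the identity to Ind Res and
   eps back whose composite eps eta is the identity. *)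
Definition id_summand_ind_res D : Prop :=
  exists (eta : forall M : block_mod B, {linear M -> indmod (resmod D M)})
         (eps : forall M : block_mod B, {linear indmod (resmod D M) -> M}),
  [/\ forall (M M' : block_mod B) (phi : {linear M -> M'}) m,
        eta M' (phi m) = ind_map (res_map D phi) (eta M m),
      forall (M M' : block_mod B) (phi : {linear M -> M'}) f,
        eps M' (ind_map (res_map D phi) f) = phi (eps M f) &
      forall (M : block_mod B) m, eps M (eta M m) = m].

(* Smallest is with respect to inclusion; the subgroups satisfying this are
   conjugate in G. *)
Definition defect_group D : Prop :=
  id_summand_ind_res D /\
  forall E : {group gT}, id_summand_ind_res E -> E \subset D -> E :=: D.

End Defect.

(* Main.v *)
From HB Require Import structures.
Require Import Defs.
From mathcomp Require Import all_boot all_order all_algebra.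
From mathcomp Require Import all_fingroup all_solvable.
From mathcomp Require Import boolp classical_sets.

Set Implicit Arguments.
Unset Strict Implicit.
Unset Printing Implicit Defensive.

Import GRing.Theory.

(** Let E be an elementary abelian subgroup of D of maximal order 2^r, with
    basis g_1, ..., g_r, and write x_i = g_i - 1.  The x_i commute and have
    square 0 because the characteristic is 2, so every linear combination u of
    them has square 0, and u acts as a differential on every kE-module; the
    product x_1 ... x_r is the sum of the elements of E.

    The Loewy length enters through a genericity argument.  Over an infinite
    field K, choose u such that left multiplication by u on A / J(A), for
    A = KG, has the largest possible rank.  Then each x_i kills the homology of
    u on A / J(A), for otherwise u + c x_i would have a larger rank for some c
    ([rank_max_kermx], [generic_combination]).  As A / J(A) is semisimple, there
    is w with u - uwu in J(A) ([jacobson_regular]), and the vanishing on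
    homology becomes a property of ring elements: (1 - uw) x_i (1 - wu) lies in
    J(A).  Now let e be the block idempotent and suppose J(Ae)^r = 0.  Starting
    from y = (u - uwu)e, which lies in J(Ae), and replacing y by (1 - uw) x_i y
    for r - 1 of the indices i, each step goes one power of the radical deeper
    and changes x_i y only by an element of uAu ([ghost_chain]).  The last y is
    therefore 0, and the conclusion is that x_1 ... x_r e = ubu for some b
    ([commuting_prod_sandwich]).  One step is saved at the start: y lies in the
    radical already, and this is why the bound is strict.

    Such an equation is impossible for a block with defect group D.  Deleting
    the coefficients outside C_G(E) is linear over KE on both sides, so it turns
    the equation into x_1 ... x_r c = u b' u = b' u^2 = 0, where c is the image
    of e under the Brauer map.  But c is idempotent, and it is not 0 because e
    has a nonzero coefficient at some element of C_G(D), which lies in C_G(E);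
    and KG is free over KE, so that a nonzero idempotent commuting with E is not
    killed by the sum of the elements of E ([brauer_map_no_sandwich]).

    The nonzero coefficient on C_G(D) comes from Higman's criterion: the
    identity of B-mod is a summand of Ind Res for a subgroup Q exactly when e is
    a relative trace from Q ([id_summand_trace], [trace_id_summand]).  Writing e
    as a combination of D-class sums, which are relative traces from centralisers
    in D, shows that e is a sum of terms e(g) Tr(c g), with traces from C_D(g);
    the centre of B is local, so that one term is invertible, and minimality of
    D forces C_D(g) = D ([defect_group_brauer]).

    The field k may be finite, so the genericity argument is run over the field
    K of rational functions in one variable.  The radical does not grow beyond
    the extension of J(B): the top coefficient of a polynomial lying in
    the radical over K generates a nil left ideal over k, hence lies in the
    radical over k ([jacobson_ext]). *)

Local Open Scope ring_scope.

(** * Jacobson radicals of rings of finite length *)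

Lemma ex_max_measure (T : Type) (P : T -> Prop) (f : T -> nat) b :
  (exists x, P x) -> (forall x, P x -> (f x <= b)%N) ->
  exists x, P x /\ forall y, P y -> (f y <= f x)%N.
Proof.
move=> [x0 Px0] fb; pose Q n := `[< exists x, P x /\ f x = n >].
have exQ : exists n, Q n by exists (f x0); apply/asboolP; exists x0.
have Qb n : Q n -> (n <= b)%N by move=> /asboolP [x [Px <-]]; apply: fb.
case: (ex_maxnP exQ Qb) => m /asboolP [x [Px fx]] mmax.
by exists x; split=> // y Py; rewrite fx; apply: mmax; apply/asboolP; exists y.
Qed.

Lemma ex_min_measure (T : Type) (P : T -> Prop) (f : T -> nat) :
  (exists x, P x) -> exists x, P x /\ forall y, P y -> (f x <= f y)%N.
Proof.
move=> [x0 Px0]; pose Q n := `[< exists x, P x /\ f x = n >].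
have exQ : exists n, Q n by exists (f x0); apply/asboolP; exists x0.
case: (ex_minnP exQ) => m /asboolP [x [Px fx]] mmin.
by exists x; split=> // y Py; rewrite fx; apply: mmin; apply/asboolP; exists y.
Qed.

(** A strictly monotone measure on left ideals bounds the length of all chains
    of left ideals, and gives maximal and minimal left ideals with prescribed
    properties without any choice of a composition series. *)
Definition finite_length (A : pzRingType) : Prop :=
  exists l : set A -> nat, forall I I', left_ideal I -> left_ideal I' ->
    (I `<=` I')%classic -> ~ (I' `<=` I)%classic -> (l I < l I')%N.

Section RingRadical.
Variable A : pzRingType.
Implicit Types (I J L M N : set A) (a b u w x y : A).
Local Open Scope classical_set_scope.

Lemma lidealN I x : left_ideal I -> I x -> I (- x).
Proof. by case=> _ _ IM Ix; rewrite -mulN1r; apply: IM. Qed.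

Lemma lidealB I x y : left_ideal I -> I x -> I y -> I (x - y).
Proof. by move=> lI Ix Iy; case: (lI) => _ ID _; apply: ID => //; apply: lidealN. Qed.

Lemma lideal_sum I n (F : 'I_n -> A) :
  left_ideal I -> (forall i, I (F i)) -> I (\sum_i F i).
Proof. by case=> I0 ID _ IF; elim/big_ind: _. Qed.

Definition principal a : set A := fun x => exists b, x = b * a.

Lemma principal_lideal a : left_ideal (principal a).
Proof.
split=> [|_ _ [x ->] [y ->]|b _ [x ->]]; first by exists 0; rewrite mul0r.
  by exists (x + y); rewrite mulrDl.
by exists (b * x); rewrite mulrA.
Qed.

Definition lideal_add I J : set A := fun x => exists y z, [/\ I y, J z & x = y + z].

Lemma lideal_addP I J : left_ideal I -> left_ideal J -> left_ideal (lideal_add I J).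
Proof.
move=> [I0 ID IM] [J0 JD JM]; split; first by exists 0, 0; rewrite addr0.
  move=> _ _ [x [y [Ix Jy ->]]] [x' [y' [Ix' Jy' ->]]].
  by exists (x + x'), (y + y'); split; [apply: ID|apply: JD|rewrite addrACA].
move=> a _ [x [y [Ix Jy ->]]].
by exists (a * x), (a * y); split; [apply: IM|apply: JM|rewrite mulrDr].
Qed.

Lemma lideal_cap I J : left_ideal I -> left_ideal J -> left_ideal (I `&` J).
Proof.
move=> [I0 ID IM] [J0 JD JM]; split=> // [x y [Ix Jx] [Iy Jy]|a x [Ix Jx]].
  by split; [apply: ID|apply: JD].
by split; [apply: IM|apply: JM].
Qed.

Lemma jacobson_lideal : left_ideal (@jacobson A).
Proof.
split=> [I [[]]//|x y Jx Jy I mI|a x Jx I mI]; case: (mI) => -[_ ID IM] _ _.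
  by apply: ID; [apply: Jx|apply: Jy].
by apply: IM; apply: Jx.
Qed.

Lemma ideal_mul_lideal I J : left_ideal I -> left_ideal (ideal_mul I J).
Proof.
move=> [I0 ID IM]; split.
  by exists 0%N, (fun=> 0), (fun=> 0); split=> [[]|[]|]; rewrite ?big_ord0.
  move=> _ _ [m [a [b [Ia Jb ->]]]] [n [a' [b' [Ia' Jb' ->]]]].
  pose h T (f : 'I_m -> T) (g : 'I_n -> T) (i : 'I_(m + n)) :=
    match split i with inl j => f j | inr j => g j end.
  exists (m + n)%N, (h _ a a'), (h _ b b'); rewrite /h.
  split=> [i|i|]; [by case: split|by case: split|].
  rewrite big_split_ord; congr (_ + _); apply: eq_bigr => i _.
    by case: split_ordP => j /eqP; rewrite ?eq_lshift ?eq_lrshift // => /eqP->.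
  by case: split_ordP => j /eqP; rewrite ?eq_rshift ?eq_rlshift // => /eqP->.
move=> c _ [m [a [b [Ia Jb ->]]]]; exists m, (fun i => c * a i), b.
split=> // [i|]; first exact: IM.
by rewrite mulr_sumr; apply: eq_bigr => i _; rewrite mulrA.
Qed.

Lemma ideal_mulP I J x y : I x -> J y -> ideal_mul I J (x * y).
Proof.
by move=> Ix Jy; exists 1%N, (fun=> x), (fun=> y); split; rewrite ?big_ord1.
Qed.

Lemma ideal_mul_sub I J L : left_ideal L ->
  (forall x y, I x -> J y -> L (x * y)) -> ideal_mul I J `<=` L.
Proof. by move=> lL IJL _ [n [a [b [Ia Jb ->]]]]; apply: lideal_sum => // i; apply: IJL. Qed.

Lemma ideal_exp_lideal I n : left_ideal I -> left_ideal (ideal_exp I n).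
Proof. by move=> lI; case: n => [|n] //=; apply: ideal_mul_lideal. Qed.

Lemma ideal_exp_eq0_leq I m n : left_ideal I -> (m <= n)%N ->
  ideal_exp I m = [set 0] -> ideal_exp I n = [set 0].
Proof.
move=> lI /subnK <-; elim: (n - m)%N => // d IH /IH{IH} E.
have [Z _ _] := ideal_exp_lideal (d + m).+1 lI.
rewrite addSn; apply/seteqP; split=> [|_ ->//] /=.
rewrite /= E => _ [k [a [b [_ b0 ->]]]] /=.
by rewrite big1 // => i _; rewrite [b i]b0 mulr0.
Qed.

Lemma geom_inverse a n : a ^+ n = 0 -> (\sum_(j < n) a ^+ j) * (1 - a) = 1.
Proof.
move=> an; suff : (\sum_(j < n) a ^+ j) * (1 - a) = 1 - a ^+ n.
  by rewrite an subr0.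
elim: n {an} => [|n IH]; first by rewrite big_ord0 mul0r subrr.
by rewrite big_ord_recr /= mulrDl IH mulrBr mulr1 -exprSr addrA subrK.
Qed.

Lemma maximal_outside I x : maximal_left_ideal I -> ~ I x ->
  exists a i, I i /\ 1 = a * x + i.
Proof.
move=> [lI I1 Imax] Ix; apply: contrapT => no1; apply: Ix.
have lS := lideal_addP (principal_lideal x) lI.
apply: (Imax _ lS) => [[_ [i [[a ->] Ii E]]]|y Iy|]; first by apply: no1; exists a, i.
  by exists 0, y; split=> //; [case: (principal_lideal x)|rewrite add0r].
by exists x, 0; split; [exists 1; rewrite mul1r|case: lI|rewrite addr0].
Qed.

(** If a lay outside a maximal left ideal I, then 1 - ba would lie in I for some
    b, but it is invertible because ba is nilpotent. *)
Lemma nil_jacobson a :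
  (forall b, exists n, (b * a) ^+ n = 0) -> jacobson a.
Proof.
move=> nil_a I mI; apply: contrapT => /(maximal_outside mI) [b [i [Ii E]]].
have [n /geom_inverse ban] := nil_a b; have [[_ _ IM] I1 _] := mI.
apply: I1; rewrite -ban E -[X in _ * (X - _)]E.
suff -> : 1 - b * a = i by apply: IM.
by rewrite E addrC addKr.
Qed.

Hypothesis flA : finite_length A.

(** The quotient by the radical is von Neumann regular.  A left ideal C that is
    minimal with Au + C = A meets Au inside the radical: a maximal left ideal
    missing an element of this intersection would cut C down further.  Writing
    1 = wu + c with c in C, the element u - uwu = uc lies in both. *)
Lemma jacobson_regular u : exists w, jacobson (u - u * w * u).
Proof.
have [l lmono] := flA.
pose P C := left_ideal C /\ exists w c, C c /\ 1 = w * u + c.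
have exP : exists C, P C by exists [set: A]; split=> //; exists 0, 1; rewrite mul0r add0r.
have [C [[lC [w [c [Cc E]]]] Cmin]] := ex_min_measure l exP.
have capJ x : C x -> principal u x -> jacobson x.
  move=> Cx [y ux] I mI; apply: contrapT => Ix.
  have [a [i [Ii E1]]] := maximal_outside mI Ix; have [lI _ _] := mI.
  (* 1 = ax + i turns c into cax + ci, where cax lies in Au and ci in C and I. *)
  suff /Cmin : P (C `&` I).
    rewrite leqNgt lmono //; first exact: lideal_cap.
    by move=> /(_ _ Cx) [].
  split; first exact: lideal_cap.
  exists (w + c * a * y), (c * i); split.
    have ci : c * i = c - (c * a) * x by rewrite -mulrA -[X in X - _]mulr1 E1 mulrDr addrC addKr.
    split; last by case: lI => _ _; apply.
    by rewrite ci; apply: lidealB => //; case: lC => _ _; apply.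
  by rewrite mulrDl -addrA -!mulrA -ux -mulrDr -E1 mulr1.
exists w; have Ec : c = 1 - w * u by rewrite E addrC addKr.
have -> : u - u * w * u = u * c by rewrite Ec mulrBr mulr1 mulrA.
apply: capJ; first by case: lC => _ _; apply.
by exists (1 - u * w); rewrite Ec mulrBr mulrBl mulr1 mul1r mulrA.
Qed.

(** Nakayama's lemma, in the form JM <> M: if N is maximal among the proper left
    ideals inside M, then M / N is simple, hence killed by J. *)
Lemma jacobson_mul_proper M : left_ideal M -> ~ (M `<=` [set 0]) ->
  exists N, [/\ left_ideal N, ideal_mul (@jacobson A) M `<=` N, N `<=` M & ~ (M `<=` N)].
Proof.
have [l lmono] := flA => lM M0.
pose P N := [/\ left_ideal N, N `<=` M & ~ (M `<=` N)].
have exP : exists N, P N.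
  exists [set 0]; split=> // [|x ->]; last by case: lM.
  by split=> // [x y -> ->|a x ->] /=; rewrite ?addr0 ?mulr0.
have Pb N : P N -> (l N <= l M)%N by case=> lN NM MN; apply/ltnW/lmono.
have [N [[lN NM MN] Nmax]] := ex_max_measure exP Pb.
exists N; split=> //; apply: ideal_mul_sub => // j m Jj Mm.
have [Nm|Nm] := pselect (N m); first by case: lN => _ _; apply.
suff /Jj : maximal_left_ideal (fun a => N (a * m)) by [].
have [N0 ND NMu] := lN.
split=> [|/=|J lJ J1 NJ x Jx]; last 1 first.
- pose N' := lideal_add N (fun y => exists2 b, J b & y = b * m).
  have lN' : left_ideal N'.
    apply: lideal_addP => //; case: lJ => J0 JD JM.
    split=> [|_ _ [b Jb ->] [c Jc ->]|b _ [c Jc ->]]; first by exists 0; rewrite ?mul0r.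
      by exists (b + c); rewrite ?mulrDl //; apply: JD.
    by exists (b * c); rewrite ?mulrA //; apply: JM.
  have NN' : N `<=` N'.
    move=> y Ny; exists y, 0; rewrite addr0; split=> //.
    by exists 0; rewrite ?mul0r //; case: lJ.
  suff N'N : N' `<=` N by apply: N'N; exists 0, (x * m); rewrite add0r; split=> //; exists x.
  apply: contrapT => N'N; have := lmono _ _ lN lN' NN' N'N.
  rewrite ltnNge Nmax //; split=> // [_ [n [_ [Nn [b Jb ->] ->]]]|MN'].
    by case: lM => _ MD MM; apply: MD; [apply: NM|apply: MM].
  have [n [_ [Nn [b Jb ->] mE]]] := MN' m Mm.
  apply: J1; rewrite -[1](subrK b); case: (lJ) => _ JD _; apply: JD => //.
  by apply: NJ; rewrite mulrBl mul1r {1}mE addrK.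
- split=> [|a b Na Nb|a b Nb]; first by rewrite mul0r.
    by rewrite mulrDl; apply: ND.
  by rewrite -mulrA; apply: NMu.
- by rewrite mul1r.
Qed.

(** The powers of the radical descend strictly until they vanish, by
    [jacobson_mul_proper]. *)
Lemma jacobson_nilpotent : exists n, ideal_exp (@jacobson A) n = [set 0].
Proof.
have [l lmono] := flA; set J := @jacobson A.
have lJ n : left_ideal (ideal_exp J n) := ideal_exp_lideal n jacobson_lideal.
apply: contrapT => noJ; have J0 n : ~ (ideal_exp J n `<=` [set 0]).
  by move=> Jn; apply: noJ; exists n; apply/seteqP; split=> // _ ->; case: (lJ n).
have bnd n : (l (ideal_exp J n) + n <= l [set: A])%N.
  elim: n => [|n IH]; first by rewrite addn0.
  apply: leq_trans IH; rewrite addnS ltn_add2r.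
  have [N [lN JN NM MN]] := jacobson_mul_proper (lJ n) (J0 n).
  apply: lmono => [//|//|x /JN/NM//|MJ]; apply: MN => x /MJ; exact: JN.
by have := bnd (l [set: A]).+1; rewrite addnS ltnNge leq_addl.
Qed.

Lemma ideal_exp_expr I a n : I a -> ideal_exp I n (a ^+ n).
Proof. by move=> Ia; elim: n => // n IH; rewrite exprS; apply: ideal_mulP. Qed.

Lemma jacobson_nil a : jacobson a -> exists n, a ^+ n = 0.
Proof.
have [n Jn] := jacobson_nilpotent => Ja; exists n.
by have := ideal_exp_expr n Ja; rewrite Jn.
Qed.

(** Membership in the radical amounts to generating a nil left ideal, and
    (c(ab))^(n+1) = ca ((bc)a)^n b. *)
Lemma jacobson_rideal a b : jacobson a -> jacobson (a * b).
Proof.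
move=> Ja; apply: nil_jacobson => c.
have [_ _ JM] := jacobson_lideal.
have [n bcan] := jacobson_nil (JM (b * c) _ Ja); exists n.+1.
have -> : (c * (a * b)) ^+ n.+1 = c * a * (b * c * a) ^+ n * b.
  elim: n {bcan} => [|n IH]; first by rewrite expr0 expr1 mulr1 mulrA.
  by rewrite exprS IH exprS !mulrA.
by rewrite bcan mulr0 mul0r.
Qed.

(** The principal left ideals of the powers of z decrease, hence become
    stationary; the resulting y makes y z^n idempotent when z is central. *)
Lemma fitting z : exists n y, z ^+ n.+1 = y * (z ^+ n.+1 * z ^+ n.+1).
Proof.
have [l lmono] := flA.
have [_ [[n ->] nmin]] := ex_min_measure l
  (ex_intro (fun I => exists n, I = principal (z ^+ n.+1)) _ (ex_intro _ 0%N erefl)).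
have sub : principal (z ^+ (n.+1 + n.+1)) `<=` principal (z ^+ n.+1).
  by move=> _ [b ->]; exists (b * z ^+ n.+1); rewrite -mulrA -exprD.
have [y Ey] : principal (z ^+ (n.+1 + n.+1)) (z ^+ n.+1).
  apply: contrapT => ny.
  have := nmin _ (ex_intro _ (n + n.+1)%N erefl); rewrite -addSn leqNgt lmono //.
  1,2: exact: principal_lideal.
  by apply: (contra_not _ ny) => /(_ (z ^+ n.+1)); apply; exists 1; rewrite mul1r.
by exists n, y; rewrite -exprD.
Qed.

End RingRadical.

(** * Subspaces of row vectors and matrices of maximal rank *)

Definition subspace (k : fieldType) (V : lmodType k) (S : set V) : Prop :=
  [/\ S 0, forall x y, S x -> S y -> S (x + y) & forall c x, S x -> S (c *: x)].

Section LinearAlgebra.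
Variable k : fieldType.

Lemma subspace_rowspace n (S : set 'rV[k]_n) : subspace S ->
  exists M : 'M[k]_n, forall v, S v <-> (v <= M)%MS.
Proof.
move=> [S0 SD SZ].
pose P (M : 'M[k]_n) := forall v : 'rV_n, (v <= M)%MS -> S v.
have exP : exists M, P M by exists 0 => v; rewrite submx0 => /eqP->.
have [M [PM Mmax]] := ex_max_measure exP (fun M _ => rank_leq_row M).
exists M => v; split=> [Sv|]; last exact: PM.
have : P (M + v)%MS.
  move=> w /sub_addsmxP [[a b] /= ->].
  apply: SD; first by apply: PM; apply: submxMl.
  by have /sub_rVP [c ->] := submxMl b v; apply: SZ.
move=> /Mmax rk; apply: contraTT rk => vM; rewrite -ltnNge rank_ltmx //.
by rewrite ltmxE addsmxSl addsmx_sub submx_refl.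
Qed.

Lemma finite_length_embedding (A : lalgType k) n (f : {linear A -> 'rV[k]_n}) :
  injective f -> finite_length A.
Proof.
move=> f_inj.
have ex I : exists M : 'M[k]_n, left_ideal I ->
    forall v, (exists2 a, I a & v = f a) <-> (v <= M)%MS.
  have [lI|] := pselect (left_ideal I); last by exists 0.
  have [|M MP] := @subspace_rowspace n (fun v => exists2 a, I a & v = f a); last by exists M.
  case: lI => I0 ID IM.
  split=> [|_ _ [x Ix ->] [y Iy ->]|c _ [x Ix ->]]; first by exists 0; rewrite ?linear0.
    by exists (x + y); rewrite ?linearD //; apply: ID.
  by exists (c *: x); rewrite ?linearZ // -[x]mul1r scalerAl; apply: IM.
have [M MP] := choice ex.
exists (fun I => \rank (M I)) => I I' lI lI' II' I'I; apply: rank_ltmx.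
have sub J J' : left_ideal J -> left_ideal J' ->
    (J `<=` J')%classic <-> (M J <= M J')%MS.
  move=> lJ lJ'; split=> [JJ'|/row_subP JJ' x Jx].
    apply/row_subP=> i; have /MP - /(_ lJ) [x Jx ->] := row_sub i (M J).
    by apply/(MP _ lJ'); exists x => //; apply: JJ'.
  have /(MP _ lJ) fx : exists2 a, J a & f x = f a by exists x.
  have /(MP _ lJ') [y Jy /f_inj ->//] : (f x <= M J')%MS.
  by apply: submx_trans fx _; apply/row_subP.
rewrite ltmxE; apply/andP; split; first exact/(sub _ _ lI lI').
by apply/negP => /(sub _ _ lI' lI).
Qed.

Definition infinite_field := exists c : nat -> k, injective c.

Lemma nonroot_neq0 (p : {poly k}) : infinite_field -> p != 0 ->
  exists c, c != 0 /\ p.[c] != 0.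
Proof.
move=> [c c_inj] p0; pose q := p * 'X.
have q0 : q != 0 by rewrite mulf_neq0 ?polyX_eq0.
pose s := [seq c i | i <- iota 0 (size q)].
have us : uniq s by rewrite map_inj_uniq ?iota_uniq.
have /allPn [x _ qx] : ~~ all (root q) s.
  by apply/negP => /(max_poly_roots q0) /(_ us); rewrite size_map size_iota ltnn.
exists x; move: qx; rewrite /root /q hornerMX mulf_eq0 negb_or => /andP[] //.
Qed.

(** If a kernel vector x of U had its image xV outside the row space of U, then
    for some nonzero c a basis of the row space of U, perturbed by cV, would still
    be independent of xV = c^-1 x(U + cV), and U + cV would have a larger rank.
    Independence is detected by a determinant polynomial in c with value 1 at
    0. *)
Lemma rank_max_kermx n (U V : 'M[k]_n) : infinite_field ->
  (forall c, \rank (U + c *: V)%R <= \rank U)%N -> (kermx U *m V <= U)%MS.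
Proof.
move=> kinf Umax; apply/row_subP => i; rewrite row_mul.
set x := row i _; apply: contrapT => /negP xVU.
have xU : x *m U = 0 by apply/sub_kermxP; apply: row_sub.
set r := \rank U in Umax; have [Y EY] : exists Y, row_base U = Y *m U.
  by apply/submxP; rewrite eq_row_base.
pose N c := col_mx (Y *m (U + c *: V)) (x *m V).
have freeN0 : row_free (N 0).
  rewrite /row_free eqn_leq rank_leq_row /N scale0r addr0 -EY -addsmxE.
  have : (row_base U < row_base U + x *m V)%MS.
    by rewrite ltmxE addsmxSl addsmx_sub submx_refl eq_row_base.
  by move/rank_ltmx; rewrite eq_row_base addn1.
have [Z NZ] := row_freeP freeN0.
(* N c is affine in c, and N 0 has a right inverse Z because xV is not in the row
   space of U. *)
pose W := col_mx (Y *m V) (0 : 'rV_n).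
have NE c : N c = N 0 + c *: W.
  by rewrite /N /W scale0r addr0 scale_col_mx add_col_mx scaler0 addr0 mulmxDr scalemxAr.
pose q := \det (1%:M + 'X *: map_mx polyC (W *m Z)).
have qE c : q.[c] = \det (N c *m Z).
  rewrite -horner_evalE -det_map_mx; congr (\det _).
  rewrite NE mulmxDl NZ -scalemxAl map_mxD map_mx1 map_mxZ /= horner_evalE hornerX.
  by congr (_ + _ *: _); apply/matrixP=> a b; rewrite !mxE horner_evalE hornerC.
have q0 : q != 0.
  by apply/eqP => q0; have := qE 0; rewrite q0 horner0 NZ det1 => /eqP; rewrite eq_sym oner_eq0.
have [c [c0 qc]] := nonroot_neq0 kinf q0.
have : row_free (N c).
  apply/row_freeP; exists (Z *m invmx (N c *m Z)).
  by rewrite mulmxA mulmxV // unitmxE unitfE -qE.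
rewrite /row_free => /eqP rN; have := Umax c.
suff /mxrankS : (N c <= (U + c *: V)%R)%MS.
  by rewrite rN => le1 le2; have := leq_trans le1 le2; rewrite addn1 ltnn.
rewrite /N col_mx_sub; apply/andP; split; first exact: submxMl.
apply/submxP; exists (c^-1 *: x).
by rewrite mulmxDr -scalemxAl xU scaler0 add0r -scalemxAr -scalemxAl scalerA mulfV // scale1r.
Qed.

End LinearAlgebra.

(** * Extension of scalars to rational functions *)

Lemma fraction_clear (R : idomainType) (x : {fraction R}) :
  exists n d : R, d != 0 /\ tofrac d * x = tofrac n.
Proof.
elim/quotW: x => r; exists (frac r).1, (frac r).2; split; first exact: denom_ratioP.
unlock tofrac; rewrite -[LHS]FracField.pi_mul; apply/eqmodP.
rewrite /= FracField.equivfE /FracField.mulf.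
by rewrite !numden_Ratio ?(oner_neq0, mul1r, mulr1, mulf_neq0) ?denom_ratioP // mulrC.
Qed.

Lemma fraction_common_denominator (R : idomainType) (I : finType) (x : I -> {fraction R}) :
  exists (d : R) (n : I -> R), d != 0 /\ forall i, tofrac d * x i = tofrac (n i).
Proof.
have /choice [n /choice [d nd]] i := fraction_clear (x i).
exists (\prod_i d i), (fun i => n i * \prod_(j | j != i) d j); split=> [|i].
  by apply/prodf_neq0 => i _; case: (nd i).
by case: (nd i) => _ xi; rewrite (bigD1 i) //= rmorphM mulrAC xi -rmorphM.
Qed.

Section FiniteLengthGroupAlgebra.
Variables (k : fieldType) (gT : finGroupType).
Local Notation kG := (group_algebra k gT).

Definition galg_row (a : kG) : 'rV[k]_#|gT| := \row_i a (enum_val i).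

Lemma galg_row_linear : linear galg_row.
Proof. by move=> c a b; apply/rowP=> i; rewrite !mxE !ffunE. Qed.

HB.instance Definition _ := GRing.isLinear.Build k kG 'rV[k]_#|gT| _ galg_row galg_row_linear.

Lemma galg_row_inj : injective galg_row.
Proof.
by move=> a b /rowP ab; apply/ffunP=> g; have := ab (enum_rank g); rewrite !mxE enum_rankK.
Qed.

Lemma galg_row_surj v : exists a, galg_row a = v.
Proof.
by exists [ffun g => v 0 (enum_rank g)]; apply/rowP=> i; rewrite mxE ffunE enum_valK.
Qed.

Lemma finite_length_galg : finite_length kG.
Proof. exact: finite_length_embedding galg_row_inj. Qed.

Variable B : block k gT.

Definition block_row (a : block_algebra B) := galg_row (\val a).

Lemma block_row_linear : linear block_row.
Proof. by move=> c a b; rewrite /block_row -linearP. Qed.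

HB.instance Definition _ :=
  GRing.isLinear.Build k (block_algebra B) 'rV[k]_#|gT| _ block_row block_row_linear.

Lemma finite_length_block : finite_length (block_algebra B).
Proof. by apply: (@finite_length_embedding _ _ _ block_row) => a b /galg_row_inj /val_inj. Qed.

End FiniteLengthGroupAlgebra.

Section BaseChange.
Variables (k K : fieldType) (f : {rmorphism k -> K}) (gT : finGroupType).
Local Notation kG := (group_algebra k gT).
Local Notation KG := (group_algebra K gT).

Definition galg_map (a : kG) : KG := [ffun g => f (a g)].

Lemma galg_map_zmod : zmod_morphism galg_map.
Proof. by move=> a b; apply/ffunP=> g; rewrite !ffunE rmorphB. Qed.

Lemma galg_map_monoid : monoid_morphism galg_map.
Proof.
split=> [|a b]; apply/ffunP=> g; rewrite !ffunE ?rmorph_nat // rmorph_sum.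
by apply: eq_bigr => h _; rewrite rmorphM !ffunE.
Qed.

HB.instance Definition _ := GRing.isZmodMorphism.Build kG KG galg_map galg_map_zmod.
HB.instance Definition _ := GRing.isMonoidMorphism.Build kG KG galg_map galg_map_monoid.

Lemma galg_map_inj : injective galg_map.
Proof.
move=> a b /ffunP ab; apply/ffunP=> g; have := ab g.
by rewrite !ffunE => /fmorph_inj.
Qed.

Lemma galg_map_elt x : galg_map (galg_elt k x) = galg_elt K x.
Proof. by apply/ffunP=> y; rewrite !ffunE rmorph_nat. Qed.

Variable B : block k gT.
Local Notation A := (block_algebra B).

Lemma block_valM (a b : A) : \val (a * b) = \val a * \val b.
Proof. by []. Qed.

(** The K-span of the image of I, as the smallest subspace containing it: this
    turns every statement about it into a statement about generators. *)
Definition scalar_ext (I : set A) : set KG := fun x =>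
  forall S : set KG, subspace S -> (forall a, I a -> S (galg_map (\val a))) -> S x.

Lemma scalar_ext_subspace I : subspace (scalar_ext I).
Proof.
split=> [S [S0 _ _] _//|x y Ix Iy S sS IS|c x Ix S sS IS]; case: (sS) => _ SD SZ.
  by apply: SD; [apply: Ix|apply: Iy].
by apply: SZ; apply: Ix.
Qed.

Lemma scalar_ext_map (I : set A) a : I a -> scalar_ext I (galg_map (\val a)).
Proof. by move=> Ia S _; apply. Qed.

Lemma scalar_ext_mul I J x y :
  scalar_ext I x -> scalar_ext J y -> scalar_ext (ideal_mul I J) (x * y).
Proof.
have [E0 ED EZ] := scalar_ext_subspace (ideal_mul I J).
move=> Ix Jy; apply: (Ix (fun x => scalar_ext (ideal_mul I J) (x * y))) => [|a Ia].
  split=> [|b c|c b]; first by rewrite mul0r.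
    by rewrite mulrDl; apply: ED.
  by rewrite -scalerAl; apply: EZ.
apply: (Jy (fun y => scalar_ext (ideal_mul I J) (galg_map (val a) * y))) => [|b Jb].
  split=> [|b c|c b]; first by rewrite mulr0.
    by rewrite mulrDr; apply: ED.
  by rewrite -scalerAr; apply: EZ.
by rewrite -rmorphM; apply: (scalar_ext_map (ideal_mulP Ia Jb)).
Qed.

Lemma scalar_ext0 x : scalar_ext [set 0]%classic x -> x = 0.
Proof.
move=> /(_ (fun y => y = 0)); apply=> [|_ ->]; last exact: (rmorph0 galg_map).
by split=> [|_ _ -> ->|c _ ->]; rewrite ?addr0 ?scaler0.
Qed.

(** Multiplication by a group element is multiplication by its image in the
    block, which is defined over k. *)
Lemma scalar_ext_lideal I : left_ideal I -> left_ideal (scalar_ext I).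
Proof.
have [E0 ED EZ] := scalar_ext_subspace I.
move=> lI; split=> // y x Ix; rewrite [y]galg_sumE mulr_suml.
apply: big_ind => // g _; rewrite -scalerAl; apply: (EZ).
apply: (Ix (fun x => scalar_ext I (galg_elt K g * x))) => [|a Ia].
  split=> [|b c|c b]; first by rewrite mulr0.
    by rewrite mulrDr; apply: ED.
  by rewrite -scalerAr; apply: EZ.
have ge : galg_elt k g * block_idem B \in in_block B.
  by case: (block_idemP B) => -[ee _] _ _; rewrite unfold_in -mulrA ee.
have -> : galg_elt K g * galg_map (\val a) = galg_map (\val (BlockElt ge * a)).
  case: (block_idemP B) => -[_ eC] _ _.
  by rewrite block_valM /= -mulrA eC (eqP (valP a)) rmorphM /= galg_map_elt.

by apply: scalar_ext_map; case: lI => _ _; apply.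
Qed.

Lemma scalar_ext_one : scalar_ext setT (galg_map (block_idem B)).
Proof. exact: (@scalar_ext_map setT 1). Qed.

End BaseChange.

Section TopCoefficient.
Variable R : nzRingType.

Lemma coef_mul_top (p q : {poly R}) m n : (size p <= m.+1)%N -> (size q <= n.+1)%N ->
  (p * q)`_(m + n) = p`_m * q`_n.
Proof.
move=> sp sq; have lt_m : (m < (m + n).+1)%N by rewrite ltnS leq_addr.
rewrite coefM (bigD1 (Ordinal lt_m)) //= addKn big1 ?addr0 // => j; rewrite -val_eqE /= => jm.
case: (ltngtP j m) jm => // jm _; last by rewrite nth_default ?mul0r // (leq_trans sp).
by rewrite [q`__]nth_default ?mulr0 // (leq_trans sq) // ltn_subRL ltn_add2r.
Qed.

Lemma coef_exp_top (p : {poly R}) d n : (size p <= d.+1)%N ->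
  (size (p ^+ n) <= (d * n).+1)%N /\ (p ^+ n)`_(d * n) = p`_d ^+ n.
Proof.
move=> sp; elim: n => [|n [sIH cIH]]; first by rewrite muln0 !expr0 size_poly1 coef1.
rewrite mulnS !exprS coef_mul_top // cIH; split=> //.
apply: leq_trans (size_polyMleq _ _) _.
by have := leq_add sp sIH; rewrite addnS addSn; case: (_ + _)%N.
Qed.

End TopCoefficient.

Section RationalFunctions.
Variables (k : fieldType) (gT : finGroupType) (B : block k gT).
Local Notation K := {fraction {poly k}}.
Local Notation kG := (group_algebra k gT).
Local Notation KG := (group_algebra K gT).
Local Notation A := (block_algebra B).
Local Notation J := (@jacobson A).

Definition rat_const : k -> K := @tofrac {poly k} \o polyC.

HB.instance Definition _ := GRing.RMorphism.on rat_const.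

Lemma rat_infinite : infinite_field K.
Proof.
exists (fun n => tofrac ('X^n : {poly k})) => m n /eqP; rewrite tofrac_eq => /eqP E.
by have := congr1 (fun p : {poly k} => size p) E; rewrite !size_polyXn => -[].
Qed.

Local Notation lift := (@galg_map k K rat_const gT).
Local Notation ext := (@scalar_ext k K rat_const gT B).
Local Notation t := ((tofrac ('X : {poly k}))%:A : KG).

Lemma indeterminate_central : commr_rmorph lift t.
Proof. by move=> a; rewrite /GRing.comm -scalerAl -scalerAr mul1r mulr1. Qed.

(** Polynomials over the noncommutative ring kG, evaluated at the indeterminate
    of the field of rational functions: this identifies them with the elements of
    KG that have polynomial coefficients. *)
Definition specialize : {poly kG} -> KG := horner_morph indeterminate_central.
HB.instance Definition _ := GRing.RMorphism.on specialize.

Lemma specializeE p g :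
  specialize p g = tofrac (\sum_(i < size p) ((p`_i) g)%:P * 'X^i).
Proof.
rewrite /specialize /horner_morph horner_coef size_map_inj_poly ?rmorph0 //; last first.
  exact: galg_map_inj.
rewrite sum_ffunE rmorph_sum; apply: eq_bigr => i _.
rewrite coef_map /= exprZn expr1n -scalerAr mulr1 !ffunE rmorphM rmorphXn.
by rewrite [RHS]mulrC.
Qed.

Lemma specialize_inj p : specialize p = 0 -> p = 0.
Proof.
move=> /ffunP p0; apply/polyP=> i; rewrite coef0.
have [ip|pi] := ltnP i (size p); last by rewrite nth_default.
apply/ffunP=> g; rewrite [RHS]ffunE; have /eqP := p0 g.
rewrite specializeE ffunE tofrac_eq0 => /eqP /(congr1 (fun q : {poly k} => q`_i)).
rewrite coef0 coef_sum (bigD1 (Ordinal ip)) //= coefCM coefXn eqxx mulr1.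
rewrite big1 ?addr0 // => j; rewrite -val_eqE /= => ji.
by rewrite coefCM coefXn eq_sym (negPf ji) mulr0.
Qed.

Lemma specializeC a : specialize a%:P = lift a.
Proof. by rewrite /specialize /horner_morph map_polyC hornerC. Qed.

Lemma specialize_monomial a d :
  specialize (a%:P * 'X^d) = tofrac ('X : {poly k}) ^+ d *: lift a.
Proof.
rewrite rmorphM rmorphXn /= specializeC /specialize /horner_morph map_polyX hornerX.
by rewrite exprZn expr1n -scalerAr mulr1.
Qed.

Lemma specialize_clear (x : KG) : exists (c : K) p, c != 0 /\ c *: x = specialize p.
Proof.
have [d [n [d0 dn]]] := fraction_common_denominator x.
pose m := \max_g size (n g).
exists (tofrac d), (\poly_(i < m) ([ffun g => (n g)`_i] : kG)).
rewrite tofrac_eq0; split=> //; apply/ffunP=> g.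
rewrite specializeE ffunE [LHS]dn; congr tofrac.
apply/polyP=> i; rewrite coef_sum.
set p := \poly_(_ < _) _.
have pE j : p`_j g = (n g)`_j.
  rewrite coef_poly; case: ltnP => [_|mj]; first by rewrite ffunE.
  by rewrite ffunE nth_default // (leq_trans _ mj) // (leq_bigmax g).
have [ip|pi] := ltnP i (size p).
  rewrite (bigD1 (Ordinal ip)) //= coefCM coefXn eqxx mulr1 big1 ?addr0 ?pE // => j.
  by rewrite -val_eqE /= => ji; rewrite coefCM coefXn eq_sym (negPf ji) mulr0.
rewrite -pE nth_default // ffunE big1 // => j _; rewrite coefCM coefXn.
by rewrite (gtn_eqF (leq_trans (ltn_ord j) pi)) mulr0.
Qed.

(** J(B) is nilpotent, so its extension is a nilpotent left ideal. *)
Lemma ext_jacobson x : ext J x -> jacobson x.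
Proof.
have lJ := @jacobson_lideal A.
move=> Jx; apply: nil_jacobson => y.
have [n Jn] := jacobson_nilpotent (finite_length_block B).
have [_ _ /(_ y _ Jx) Jyx] := scalar_ext_lideal rat_const lJ.
exists n.+1; suff : ext (ideal_exp J n.+1) ((y * x) ^+ n.+1).
  by rewrite (ideal_exp_eq0_leq lJ (leqnSn n) Jn) => /scalar_ext0.
elim: {Jn} n => [|n IH]; last by rewrite exprS; apply: scalar_ext_mul.
move=> S sS IS; rewrite expr1; apply: Jyx => // a Ja; apply: IS.
by rewrite -[a]mulr1; apply: ideal_mulP.
Qed.

(** For every b the element b p is nilpotent, hence so is b times the top
    coefficient of p; this puts the top coefficient into J(B).  The top term is
    then in the radical over K as well, and can be subtracted. *)
Lemma jacobson_ext_poly n (p : {poly kG}) : (size p <= n)%N ->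
  (forall i, p`_i * block_idem B = p`_i) -> jacobson (specialize p) -> ext J (specialize p).
Proof.
have [J0 JD JM] := @jacobson_lideal KG.
have [E0 ED EZ] := scalar_ext_subspace rat_const J.
elim: n p => [|d IH] p sp pe Jp.
  by move: sp; rewrite leqn0 size_poly_eq0 => /eqP->; rewrite rmorph0.
pose a := p`_d; have ae : a \in in_block B by rewrite unfold_in pe.
have Ja : J (BlockElt ae).
  apply: nil_jacobson => b.
  have [n Jn] := jacobson_nil (finite_length_galg _ _) (JM (lift (\val b)) _ Jp).
  exists n; apply/val_inj.
  have -> : \val ((b * BlockElt ae) ^+ n) = (\val b * a) ^+ n * block_idem B.
    elim: n {Jn} => [|n IHn]; first by rewrite mul1r.
    by rewrite !exprS block_valM IHn /= !mulrA.
  move: Jn; rewrite -specializeC -rmorphM -rmorphXn => /specialize_inj Jn.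
  have [|_] := @coef_exp_top _ ((\val b)%:P * p) d n.
    by rewrite mul_polyC; apply: leq_trans (size_scale_leq _ _) sp.
  by rewrite Jn coef0 coefCM => <-; rewrite mul0r.
have pE : specialize p = specialize (p - a%:P * 'X^d) + specialize (a%:P * 'X^d).
  by rewrite -rmorphD subrK.
have Ea : ext J (specialize (a%:P * 'X^d)).
  by rewrite specialize_monomial; apply: EZ; exact: (@scalar_ext_map _ _ rat_const _ _ _ _ Ja).
rewrite pE; apply: ED => //; apply: IH.
- apply/leq_sizeP => j; rewrite leq_eqVlt => /predU1P [<-|dj].
    by rewrite coefB coefCM coefXn eqxx mulr1 subrr.
  by rewrite coefB coefCM coefXn gtn_eqF // mulr0 subr0 nth_default // (leq_trans sp).
- move=> i; rewrite coefB coefCM coefXn mulrBl pe; congr (_ - _).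
  by case: (i == d); rewrite ?mulr0 ?mul0r // !mulr1 pe.
- by rewrite rmorphB; apply: (lidealB (@jacobson_lideal KG) Jp); apply: ext_jacobson.
Qed.

(** Clear denominators: the radical is stable under multiplication by constants. *)
Lemma jacobson_ext x : jacobson x -> ext J (x * lift (block_idem B)).
Proof.
move=> Jx; have [c [p [c0 pE]]] := specialize_clear x.
have [_ _ EZ] := scalar_ext_subspace rat_const J.
rewrite -[x](scalerK c0) pE -scalerAl; apply: EZ.
rewrite -specializeC -rmorphM.
have [_ _ JM] := @jacobson_lideal KG.
apply: (jacobson_ext_poly (leqnn _)) => [i|].
  by case: (block_idemP B) => -[ee _] _ _; rewrite coefMC -mulrA ee.
rewrite rmorphM /= -pE; apply: jacobson_rideal; first exact: finite_length_galg.
by rewrite -[x]mul1r scalerAl; apply: JM.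
Qed.

End RationalFunctions.

(** * Generic combinations of commuting square-zero elements *)

Section GenericDirection.
Variables (K : fieldType) (gT : finGroupType).
Local Notation KG := (group_algebra K gT).
Implicit Types (a b u x : KG) (s : seq KG) (lam : KG -> K).

(** Row vectors are multiplied on the right by matrices, so that this matrix
    represents left multiplication by u. *)
Definition left_mul_mx u : 'M[K]_#|gT| :=
  \matrix_i galg_row (u * galg_elt K (enum_val i)).

Lemma left_mul_mxE u a : galg_row a *m left_mul_mx u = galg_row (u * a).
Proof.
rewrite mulmx_sum_row [in RHS](galg_sumE a) mulr_sumr linear_sum.
rewrite [RHS](reindex (@enum_val gT predT)) /=; last exact/onW_bij/enum_val_bij.
by apply: eq_bigr => i _; rewrite rowK mxE -scalerAr linearZ.
Qed.

Lemma left_mul_mxD u c x : left_mul_mx (u + c *: x) = left_mul_mx u + c *: left_mul_mx x.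
Proof.
apply/row_matrixP => i; rewrite linearD linearZ /= !rowK mulrDl -scalerAl.
by rewrite linearD linearZ.
Qed.

Definition lin_comb lam s : KG := \sum_(x <- s) lam x *: x.

Lemma lin_combD lam s x c : uniq s -> x \in s ->
  lin_comb (fun y => lam y + (if y == x then c else 0)) s = lin_comb lam s + c *: x.
Proof.
move=> us xs; rewrite /lin_comb.
under eq_bigr do rewrite scalerDl.
rewrite big_split /=; congr (_ + _); rewrite (bigD1_seq x) //= eqxx.
by rewrite big1 ?addr0 // => y /negPf->; rewrite scale0r.
Qed.

(** The combination is chosen so that it acts on A / J(A) with the largest
    possible rank.  The conclusion says that x annihilates the homology of the
    combination on A / J(A). *)
Lemma generic_combination s : infinite_field K -> uniq s ->
  exists lam, forall x a, x \in s -> jacobson (lin_comb lam s * a) ->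
    exists b, jacobson (x * a - lin_comb lam s * b).
Proof.
move=> Kinf us.
have [J0 JD JM] := @jacobson_lideal KG.
have [|M MP] := @subspace_rowspace K _ (fun v => exists2 a, @jacobson KG a & v = galg_row a).
  split=> [|_ _ [x Jx ->] [y Jy ->]|c _ [x Jx ->]]; first by exists 0; rewrite ?linear0.
    by exists (x + y); rewrite ?linearD //; apply: JD.
  by exists (c *: x); rewrite ?linearZ // -[x]mul1r scalerAl; apply: JM.
have JP a : jacobson a <-> galg_row a *m cokermx M = 0.
  split=> [Ja|/eqP]; first by apply/eqP; rewrite -submxE; apply/MP; exists a.
  by rewrite -submxE => /MP [b Jb /galg_row_inj ->].
pose act u := left_mul_mx u *m cokermx M.
have [||lam [_ lam_max]] :=
  @ex_max_measure (KG -> K) (fun=> True) (fun lam => \rank (act (lin_comb lam s))) #|gT|.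
- by exists (fun=> 0).
- by move=> lam _; apply: rank_leq_row.
exists lam => x a xs Ja; set u := lin_comb lam s in Ja lam_max *.
have /row_subP ker_im : (kermx (act u) *m act x <= act u)%MS.
  apply: rank_max_kermx => // c.
  apply: leq_trans (lam_max (fun y => lam y + (if y == x then c else 0)) I).
  by rewrite lin_combD // /act left_mul_mxD mulmxDl scalemxAl.
have a_ker : (galg_row a <= kermx (act u))%MS.
  by apply/sub_kermxP; rewrite mulmxA left_mul_mxE; apply/JP.
have /submxP [y yE] : (galg_row a *m act x <= act u)%MS.
  by apply: submx_trans (submxMr _ a_ker) _; apply/row_subP.
have [b bE] := galg_row_surj y; exists b; apply/JP.
rewrite -bE /act mulmxA [RHS]mulmxA !left_mul_mxE in yE.
by rewrite [galg_row _](raddfB (@galg_row K gT)) mulmxBl yE subrr.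
Qed.

End GenericDirection.

Section SquareZero.
Variables (K : fieldType) (gT : finGroupType).
Local Notation KG := (group_algebra K gT).
Implicit Types (a b u w x y : KG) (s : seq KG) (lam : KG -> K).
Hypothesis charK : 2%N \in [pchar K].

Lemma galg_addrr (a : KG) : a + a = 0.
Proof. by apply/ffunP=> g; rewrite !ffunE addrr_pchar2. Qed.

Definition commuting_square_zero (s : seq KG) :=
  {in s &, forall x y, GRing.comm x y} /\ {in s, forall x, x * x = 0}.

Lemma commuting_square_zero_sub s s' :
  {subset s' <= s} -> commuting_square_zero s -> commuting_square_zero s'.
Proof.
by move=> ss [sC s0]; split=> [x y /ss xs /ss|x /ss]; [apply: sC|apply: s0].
Qed.

Lemma lin_comb_comm lam s x : {in s, forall y, GRing.comm x y} -> GRing.comm x (lin_comb lam s).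
Proof.
move=> xs; rewrite /lin_comb big_seq; apply: commr_sum => y ys.
by rewrite /GRing.comm -scalerAl -scalerAr xs.
Qed.

Lemma prod_comm (s : seq KG) x :
  {in s, forall y, GRing.comm x y} -> GRing.comm x (\prod_(y <- s) y).
Proof. by move=> xs; rewrite big_seq; apply: commr_prod => y ys; apply: xs. Qed.

(** The mixed products occur twice and cancel in characteristic 2. *)
Lemma lin_comb_square lam s : commuting_square_zero s -> lin_comb lam s * lin_comb lam s = 0.
Proof.
elim: s => [|x s IH] cs; first by rewrite /lin_comb big_nil mulr0.
have sub : {subset s <= x :: s} by move=> y ys; rewrite inE ys orbT.
have [sC s0] := cs.
have xu : GRing.comm x (lin_comb lam s).
  by apply: lin_comb_comm => y ys; apply: sC; rewrite ?mem_head ?sub.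
rewrite /lin_comb big_cons -/(lin_comb _ _) mulrDl !mulrDr.
rewrite IH; last exact: commuting_square_zero_sub cs.
rewrite -scalerAl -scalerAr s0 ?mem_head // !scaler0 add0r addr0.
by rewrite -scalerAl -scalerAr xu galg_addrr.
Qed.

Lemma prod_rem (s : seq KG) x : commuting_square_zero s -> x \in s ->
  \prod_(y <- s) y = x * \prod_(y <- rem x s) y.
Proof.
elim: s => // y s IH cs; rewrite inE /=; have [->|yx xs] := eqVneq y x.
  by rewrite big_cons.
have sub : {subset s <= y :: s} by move=> z zs; rewrite inE zs orbT.
rewrite !big_cons IH //; last exact: commuting_square_zero_sub cs.
by have [sC _] := cs; rewrite !mulrA (sC y x) // ?mem_head ?sub.
Qed.

Lemma mem_mul_prod (s : seq KG) x : commuting_square_zero s -> x \in s ->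
  x * \prod_(y <- s) y = 0.
Proof. by move=> cs xs; rewrite (prod_rem cs xs) mulrA; case: cs => _ ->; rewrite ?mul0r. Qed.

Lemma lin_comb_mul_prod lam s x : commuting_square_zero s -> x \in s ->
  lin_comb lam s * \prod_(y <- rem x s) y = lam x *: \prod_(y <- s) y.
Proof.
move=> cs xs; rewrite /lin_comb (big_rem x) //= mulrDl -scalerAl -(prod_rem cs xs).
rewrite [X in _ + X](_ : _ = 0) ?addr0 // mulr_suml big_seq big1 // => y ys.
rewrite -scalerAl mem_mul_prod ?scaler0 //.
by apply: commuting_square_zero_sub cs => z; apply: mem_rem.
Qed.

Variables (e : KG) (F : nat -> set KG).
Hypotheses (e_central : central e) (ee : e * e = e) (F0 : F 0 e).
Hypothesis FS : forall n x y, jacobson x -> F n y -> F n.+1 (x * e * y).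

Lemma jacobson_prod (s : seq KG) : {in s, forall x, jacobson x} ->
  F (size s) ((\prod_(x <- s) x) * e).
Proof.
elim: s => [|x s IH] Js; first by rewrite big_nil mul1r.
rewrite big_cons /=; have -> : x * \prod_(y <- s) y * e = x * e * (\prod_(y <- s) y * e).
  by rewrite -[RHS]mulrA e_central -!mulrA ee.
apply: FS; first by apply: Js; rewrite mem_head.
by apply: IH => y ys; apply: Js; rewrite inE ys orbT.
Qed.

(** Since uy = 0, also (1 - wu) y = y, so that (1 - uw) v y is the product of y with
    an element of the radical; and v y - (1 - uw) v y = u (w v y) lies in uAu because
    y is a left multiple of u. *)
Lemma ghost_chain (u w : KG) (s : seq KG) n y :
    u * u = 0 -> {in s, forall v, GRing.comm u v} ->
    {in s, forall v, jacobson ((1 - u * w) * v * (1 - w * u))} ->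
    F n y -> u * y = 0 -> e * y = y -> principal u y ->
  exists y', [/\ F (n + size s) y', u * y' = 0, e * y' = y', principal u y' &
    exists c, (\prod_(v <- s) v) * y - y' = u * c * u].
Proof.
move=> uu us Js Fy uy ey yu.
elim: s us Js => [|v s IH] us Js.
  exists y; rewrite addn0; split=> //; exists 0.
  by rewrite big_nil mul1r subrr mulr0 mul0r.
have [|x xs|y' [Fy' uy' ey' [c' y'E] [c Ec]]] := IH.
- by move=> x xs; apply: us; rewrite inE xs orbT.
- by apply: Js; rewrite inE xs orbT.
have uv : u * v = v * u by apply: us; rewrite mem_head.
have E : (1 - u * w) * v * y' = (1 - u * w) * v * (1 - w * u) * e * y'.
  rewrite -[_ * e * y']mulrA ey' -[RHS]mulrA [(1 - w * u) * y']mulrBl mul1r.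
  by rewrite -[w * u * y']mulrA uy' mulr0 subr0.
exists ((1 - u * w) * v * y'); split.
- by rewrite E addnS; apply: FS => //; apply: Js; rewrite mem_head.
- rewrite !mulrA mulrBr mulr1 mulrA uu mul0r subr0 uv -mulrA uy' mulr0 //.
- by rewrite mulrA e_central -[LHS]mulrA ey'.
- by exists ((1 - u * w) * v * c'); rewrite y'E mulrA.
exists (v * c + w * v * c'); rewrite big_cons.
have -> : v * (\prod_(x <- s) x) * y = v * y' + v * (u * c * u).
  by rewrite -Ec mulrBr addrC subrK mulrA.
rewrite !mulrBl mul1r addrAC opprB [v * y' + _]addrC subrK. 
by rewrite {1}y'E mulrDr mulrDl !mulrA uv addrC.
Qed.

(** F n plays the role of the n-th power of the radical of the block; the
    hypotheses on F are stated abstractly so that the block need only be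
    defined over a subfield of K. *)
Lemma commuting_prod_sandwich (s : seq KG) : infinite_field K -> uniq s ->
    commuting_square_zero s -> (forall y, F (size s) y -> y = 0) ->
  exists lam b, (\prod_(x <- s) x) * e = lin_comb lam s * b * lin_comb lam s.
Proof.
move=> Kinf us cs Fs0.
have fl := finite_length_galg K gT.
have [lam lamP] := generic_combination Kinf us; exists lam.
set u := lin_comb lam s in lamP *.
(* If all coefficients vanish, the maximal rank is that of u = 0, so that every x lies
   in the radical and their product is already killed by e. *)
have [[x xs lamx]|lam0] := pselect (exists2 x, x \in s & lam x != 0); last first.
  have u0 : u = 0.
    rewrite /u /lin_comb big_seq big1 // => x xs.
    have [->|/eqP lx] := pselect (lam x = 0); first by rewrite scale0r.
    by case: lam0; exists x.
  exists 0; rewrite mulr0 mul0r; apply/Fs0/jacobson_prod => x xs.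
  have [|b] := lamP x 1 xs; first by rewrite u0 mul0r; case: (@jacobson_lideal KG).
  by rewrite u0 mul0r subr0 mulr1.
have [J0 JD JM] := @jacobson_lideal KG.
have [w Jw] := jacobson_regular fl u.
have uu : u * u = 0 by apply: lin_comb_square.
have uC v : v \in s -> GRing.comm u v.
  move=> vs; apply/commr_sym/lin_comb_comm => y ys; by case: cs => sC _; apply: sC.
have Jghost v : v \in s -> jacobson ((1 - u * w) * v * (1 - w * u)).
  move=> vs; have [|b Jb] := lamP v (1 - w * u) vs; first by rewrite mulrBr mulr1 mulrA.
  have -> : (1 - u * w) * v * (1 - w * u) =
            (1 - u * w) * (v * (1 - w * u) - u * b) + (u - u * w * u) * b.
    by rewrite [(1 - u * w) * (_ - u * b)]mulrBr !mulrA [(1 - u * w) * u]mulrBl mul1r subrK.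
  by apply: JD; [apply: JM|apply: jacobson_rideal].
have ss : {subset rem x s <= s} by move=> y; apply: mem_rem.
have [||||||y' [Fy' _ _ _ [c Ec]]] := @ghost_chain u w (rem x s) 1 ((u - u * w * u) * e) uu.
- by move=> v /ss; apply: uC.
- by move=> v /ss; apply: Jghost.
- by have := FS Jw F0; rewrite -[_ * e * e]mulrA ee.
- by rewrite mulrA mulrBr !mulrA uu !mul0r subrr mul0r.
- by rewrite mulrA e_central -[LHS]mulrA ee.
- by exists ((1 - u * w) * e); rewrite -[RHS]mulrA e_central [RHS]mulrA
    [(1 - u * w) * u]mulrBl mul1r.
have y'0 : y' = 0.
  apply: Fs0; move: Fy'; rewrite size_rem // add1n prednK //.
  by case: (s) xs.
have csr := commuting_square_zero_sub ss cs.
set P := \prod_(v <- rem x s) v in Ec.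
have uP : u * P = P * u by apply: prod_comm => v /ss; apply: uC.
have PE : \prod_(v <- s) v = (lam x)^-1 *: (u * P).
  by rewrite lin_comb_mul_prod // scalerA mulVf // scale1r.
(* P u e = P (u - uwu) e + P uwu e: the first term is ucu, and in the second P
   commutes with u. *)
exists ((lam x)^-1 *: (c + P * w * e)).
rewrite PE uP -scalerAl -scalerAr -scalerAl; congr (_ *: _).
rewrite y'0 subr0 in Ec.
have -> : P * u * e = P * ((u - u * w * u) * e) + P * u * w * u * e.
  by rewrite mulrBl mulrBr !mulrA subrK.
by rewrite Ec mulrDr mulrDl -uP -!mulrA e_central.
Qed.

End SquareZero.

(** * Elementary abelian 2-subgroups and their group algebras *)

Section GroupElements.
Variables (K : fieldType) (gT : finGroupType).
Local Notation KG := (group_algebra K gT).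
Implicit Types (a b c u : KG) (g h : gT).

Lemma galg_elt_mulE h a g : (galg_elt K h * a) g = a (h^-1 * g)%g.
Proof.
rewrite galg_mulE (bigD1 h) //= ffunE eqxx mul1r big1 ?addr0 // => y /negPf yh.
by rewrite ffunE yh mul0r.
Qed.

Lemma galg_mul_eltE h a g : (a * galg_elt K h) g = a (g * h^-1)%g.
Proof.
rewrite galg_mulE (bigD1 (g * h^-1)%g) //= ffunE invMg invgK mulgKV eqxx mulr1.
rewrite big1 ?addr0 // => y /negPf yh; rewrite ffunE; case: eqP => [E|]; last by rewrite mulr0.
by rewrite -E invMg invgK mulKVg eqxx in yh.
Qed.

Lemma galg_elt_inj : injective (@galg_elt K gT).
Proof.
move=> g h /ffunP/(_ g); rewrite !ffunE eqxx; case: eqP => // _ /eqP.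
by rewrite oner_eq0.
Qed.

Lemma galg_commP a : (forall g, GRing.comm a (galg_elt K g)) -> central a.
Proof.
move=> ag b; rewrite [b]galg_sumE mulr_sumr mulr_suml; apply: eq_bigr => g _.
by rewrite -scalerAl -scalerAr ag.
Qed.

Lemma central_conj a x y : central a -> a (x ^ y)%g = a x.
Proof.
move=> ca; have /ffunP/(_ (x * y)%g) := ca (galg_elt K y).
by rewrite galg_mul_eltE galg_elt_mulE mulgK conjgE mulgA => ->.
Qed.

End GroupElements.

(** F is constant on the orbits of P by conjugation, and the orbits outside the
    centraliser of P have order divisible by p. *)
Lemma sum_noncentralised (K : fieldType) (gT : finGroupType) (p : nat) (P : {group gT})
    (F : gT -> K) : p \in [pchar K] -> (p.-group P)%g ->
  (forall y h, h \in P -> F (y ^ h)%g = F y) -> \sum_(y in (~: 'C(P))%g) F y = 0.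
Proof.
move=> charK pP Finv.
have actP : [acts P, on (~: 'C(P))%g | 'J].
  apply/actsP => h hP y; rewrite !inE /=; congr (~~ _).
  by rewrite memJ_norm // (fintype.subsetP (norms_cent (normG P))).
rewrite (set_partition_big _ (orbit_partition actP)) big1 //= => O.
case/imsetP => y; rewrite inE => yC ->.
rewrite (eq_bigr (fun=> F y)) => [|_ /orbitP [h hP <-]]; last exact: Finv.
rewrite sumr_const card_orbit -mulr_natr.
suff : (p %| #|P : 'C_P[y | 'J]|%g)%N by rewrite (dvdn_pcharf charK) => /eqP->; rewrite mulr0.
have /p_natP [[|j] Ej] := pnat_dvd (dvdn_indexg P 'C_P[y | 'J]%g) pP; last by rewrite Ej dvdn_exp.
move/eqP: Ej; rewrite indexg_eq1 finset.subsetI => /andP [_ Py].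
by case/negP: yC; rewrite -sub_cent1 -astab1J.
Qed.

Section ElementaryAbelian.
Variables (K : fieldType) (gT : finGroupType).
Local Notation KG := (group_algebra K gT).
Hypothesis charK : 2%N \in [pchar K].

Definition augment (g : gT) : KG := galg_elt K g - 1.

(** A basis of E: its augmented elements multiply to the sum over E, and being
    fixed by it means being fixed by E.  The induction splits E as <x> times L,
    where (x - 1) times the sum over L is the sum over E as -1 = 1. *)
Lemma elementary_abelian_basis n (E : {group gT}) : (2.-abelem E)%g -> #|E| = (2 ^ n)%N ->
  exists s : seq gT, [/\ size s = n, {subset s <= E}, uniq s,
    \prod_(g <- s) augment g = \sum_(h in E) galg_elt K h &
    forall m : KG, {in s, forall g, galg_elt K g * m = m} ->
                   {in E, forall g, galg_elt K g * m = m}].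
Proof.
elim: n E => [|n IH] E abE cardE.
  have E1 : E :=: 1%g by apply: card1_trivg.
  exists [::]; split=> // [|m _ g]; rewrite E1; first by rewrite big_nil big_set1.
  by move=> /set1P->; rewrite galg_elt1 mul1r.
have : E :!=: 1%g.
  by rewrite -cardG_gt1 cardE expnS; apply: leq_trans (leq_pmulr _ _); rewrite ?expn_gt0.
case/trivgPn => x xE x1.
have ox : #[x]%g = 2%N by apply: (abelem_order_p abE).
have [L [LE cardL]] := p_abelem_split1 abE xE.
case/dprodP=> _ EL _ xL.
have [|s [szs sL us prods fixs]] := IH L (abelemS LE abE).
  by rewrite cardL cardE ox expnS mulKn.
have xNL : x \notin L.
  apply: contra x1 => xiL; apply/eqP/set1P.
  by rewrite -[[set _]%SET]xL inE cycle_id.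
have EP h : h \in E -> h \in L \/ exists2 l, l \in L & h = (x * l)%g.
  rewrite -EL => /imset2P [y l]; rewrite cycle2g // => /set2P [->|->] lL ->.
    by left; rewrite mul1g.
  by right; exists l.
exists (x :: s); split=> [|g||| m fixm g].
- by rewrite /= szs.
- by rewrite inE => /predU1P [->//|/sL]; apply: fintype.subsetP.
- by rewrite /= us andbT; apply: contra xNL => /sL.
- rewrite big_cons prods [RHS](bigID (fun h => h \in L)) /= [RHS]addrC /augment mulrBl mul1r.
  have -> : - (\sum_(h in L) galg_elt K h) = \sum_(h in L) galg_elt K h.
    by apply/eqP; rewrite eq_sym -addr_eq0; apply/eqP; apply: galg_addrr.
  congr (_ + _); last first.
    by apply: eq_bigl => h; apply/idP/andP => [hL|[]//]; rewrite (fintype.subsetP LE).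
  rewrite mulr_sumr [RHS](reindex_inj (mulgI x)) /=.
  under eq_bigr do rewrite -galg_eltM.
  apply: eq_bigl => h; apply/idP/andP => [hL|[/EP [->//|[l lL /mulgI->//]]]].
    split; last by rewrite groupMr.
    by apply: groupM => //; apply: (fintype.subsetP LE).
- have fixL := fixs m (fun y ys => fixm y (mem_behead (s := x :: s) ys)).
  case/EP => [|[l lL ->]]; first exact: fixL.
  by rewrite galg_eltM -mulrA fixL // fixm // mem_head.
Qed.

Lemma augment_comm (a : KG) g : GRing.comm a (galg_elt K g) -> GRing.comm a (augment g).
Proof. by move=> ag; apply: commrB => //; apply: commr1. Qed.

Lemma augment_square (E : {group gT}) (s : seq gT) : (2.-abelem E)%g -> {subset s <= E} ->
  commuting_square_zero (map augment s).
Proof.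
move=> abE sE; have [abelE expE] := abelemP (isT : prime 2) abE.
split=> [_ _ /mapP [g /sE gE ->] /mapP [h /sE hE ->]|_ /mapP [g /sE gE ->]].
  apply: augment_comm; apply/commr_sym/augment_comm; apply/commr_sym.
  rewrite /GRing.comm -!galg_eltM; congr (galg_elt K _).
  exact: (centsP abelE).
rewrite /augment mulrBl mul1r mulrBr mulr1 -galg_eltM -expg2 expE // galg_elt1.
by rewrite -(opprB _ 1) -opprD galg_addrr // oppr0.
Qed.

(** A 2-group acting on a nonzero space in characteristic 2 has nonzero fixed
    points: multiply by one x after the other as long as the result is not 0. *)
Lemma fixed_multiple (s : seq KG) m : commuting_square_zero s -> m != 0 ->
  exists q, [/\ q * m != 0, {in s, forall x, x * (q * m) = 0} &
    forall c, {in s, forall x, GRing.comm c x} -> GRing.comm c q].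
Proof.
elim: s => [|x s IH] cs m0.
  by exists 1; split; rewrite ?mul1r // => c _; apply: commr1.
have sub : {subset s <= x :: s} by move=> y ys; rewrite inE ys orbT.
have [sC s0] := cs.
have [q [qm qs qC]] := IH (commuting_square_zero_sub sub cs) m0.
have [xqm|xqm] := eqVneq (x * (q * m)) 0.
  exists q; split=> // [y|c cC]; last by apply: qC => y ys; apply/cC/sub.
  by rewrite inE => /predU1P [->//|]; apply: qs.
exists (x * q); rewrite -mulrA; split=> // [y|c cC].
  rewrite mulrA inE => /predU1P [->|ys]; first by rewrite s0 ?mem_head // mul0r.
  by rewrite (sC y x) ?mem_head ?sub // -mulrA qs // mulr0.
by apply: commrM; [apply: cC; rewrite mem_head|apply: qC => y ys; apply/cC/sub].
Qed.

(** KG is free over KE; the quotient b is supported on representatives of the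
    right cosets of E. *)
Lemma fixed_norm_multiple (E : {group gT}) (m : KG) :
  {in E, forall g, galg_elt K g * m = m} ->
  exists b, m = (\sum_(h in E) galg_elt K h) * b.
Proof.
move=> fixm; exists [ffun g => if g == repr (E :* g)%g then m g else 0].
apply/ffunP=> g; rewrite mulr_suml sum_ffunE.
have /rcosetP [h hE rE] : repr (E :* g)%g \in (E :* g)%g := mem_repr_rcoset _ _.
rewrite (bigD1 h^-1%g) ?groupV //= galg_elt_mulE invgK ffunE -rE.
rewrite (rcoset_eqP (mem_repr_rcoset E g)) eqxx big1 ?addr0 => [|l /andP [lE lh]].
  by rewrite rE -{1}(fixm h^-1%g) ?groupV // galg_elt_mulE invgK.
rewrite galg_elt_mulE ffunE.
have -> : (E :* (l^-1 * g) = E :* g)%g by apply: rcoset_eqP; rewrite mem_rcoset mulgK groupV.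
by rewrite rE (inj_eq (mulIg g)); case: eqP => // E1; rewrite -E1 invgK eqxx in lh.
Qed.

End ElementaryAbelian.

(** * The Brauer map and the length of the radical series *)

Section Brauer.
Variables (K : fieldType) (gT : finGroupType) (E : {group gT}).
Local Notation KG := (group_algebra K gT).
Implicit Types (a b c e u : KG) (g h : gT).

Definition brauer_map a : KG := [ffun g => if (g \in 'C(E))%g then a g else 0].

Lemma brauer_map_linear : linear brauer_map.
Proof.
by move=> c a b; apply/ffunP=> g; rewrite !ffunE; case: ifP; rewrite ?scaler0 ?addr0.
Qed.

HB.instance Definition _ := GRing.isLinear.Build K KG KG _ brauer_map brauer_map_linear.

(** The Brauer map is multiplicative on elements fixed by E: the terms of the
    product that come from outside the centraliser cancel orbit by orbit. *)
Lemma brauer_map_idempotent (p : nat) e : p \in [pchar K] -> (p.-group E)%g ->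
  central e -> e * e = e -> brauer_map e * brauer_map e = brauer_map e.
Proof.
move=> charK pE ce ee; apply/ffunP=> z; rewrite galg_mulE [RHS]ffunE; case: ifP => zC.
  rewrite -[in RHS]ee galg_mulE [RHS](bigID (fun y => y \in 'C(E)%g)) /=.
  rewrite [X in _ + X](_ : _ = 0).
    rewrite addr0 [RHS]big_mkcond; apply: eq_bigr => y _; rewrite !ffunE.
    by case: ifP => yC; rewrite ?mul0r // groupM ?groupV.
  rewrite -[RHS](@sum_noncentralised K gT p E (fun y => e y * e (y^-1 * z)%g) charK pE).
    by apply: eq_bigl => y; rewrite inE.
  move=> y h hE; rewrite central_conj // -[in RHS](central_conj (y^-1 * z)%g h ce) conjMg conjVg.
  by rewrite [(z ^ h)%g]conjgE (centP zC h hE) mulKg.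
rewrite big1 // => y _; rewrite !ffunE; case: ifP => yC; last by rewrite mul0r.
by rewrite groupMl ?groupV // zC mulr0.
Qed.

(** The scalars of KE: the Brauer map is linear over them on both sides, and they
    commute with its image, which is supported on the centraliser of E. *)
Definition brauer_scalar u := [/\ forall b, brauer_map (u * b) = u * brauer_map b,
  forall b, brauer_map (b * u) = brauer_map b * u & forall b, GRing.comm u (brauer_map b)].

Lemma brauer_scalar_elt g : abelian E -> g \in E -> brauer_scalar (galg_elt K g).
Proof.
move=> abE gE; have gC : g \in 'C(E)%g by apply: (fintype.subsetP abE).
split=> b; [| |rewrite /GRing.comm]; apply/ffunP=> x.
- by rewrite ffunE !galg_elt_mulE ffunE groupMl ?groupV.
- by rewrite ffunE !galg_mul_eltE ffunE groupMr ?groupV.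
rewrite galg_elt_mulE galg_mul_eltE !ffunE groupMl ?groupMr ?groupV //.
case: ifP => // xC; congr (b _).
exact/esym/commuteV/(centP xC).
Qed.

Lemma brauer_scalar1 : brauer_scalar 1.
Proof. by split=> b; rewrite /GRing.comm ?mul1r ?mulr1. Qed.

Lemma brauer_scalarD u v : brauer_scalar u -> brauer_scalar v -> brauer_scalar (u + v).
Proof.
move=> [ul ur uC] [vl vr vC]; split=> b.
- by rewrite !mulrDl linearD /= ul vl.
- by rewrite !mulrDr linearD /= ur vr.
- by apply/commr_sym/commrD; apply: commr_sym.
Qed.

Lemma brauer_scalarZ (c : K) u : brauer_scalar u -> brauer_scalar (c *: u).
Proof.
move=> [ul ur uC]; split=> b.
- by rewrite -!scalerAl linearZ /= ul.
- by rewrite -!scalerAr linearZ /= ur.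
- by rewrite /GRing.comm -scalerAl -scalerAr uC.
Qed.

Lemma brauer_scalarM u v : brauer_scalar u -> brauer_scalar v -> brauer_scalar (u * v).
Proof.
move=> [ul ur uC] [vl vr vC]; split=> b.
- by rewrite -!mulrA ul vl.
- by rewrite !mulrA vr ur.
- by apply/commr_sym/commrM; apply: commr_sym.
Qed.

Lemma brauer_scalar_augment g : abelian E -> g \in E -> brauer_scalar (augment K g).
Proof.
move=> abE gE; apply: brauer_scalarD; first exact: brauer_scalar_elt.
by rewrite -scaleN1r; apply: brauer_scalarZ brauer_scalar1.
Qed.

Lemma brauer_scalar_lin_comb lam (s : seq KG) :
  {in s, forall x, brauer_scalar x} -> brauer_scalar (lin_comb lam s).
Proof.
move=> Hs; rewrite /lin_comb big_seq; apply: big_ind => [||x xs].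
- by rewrite -(scale0r (1 : KG)); apply: brauer_scalarZ brauer_scalar1.
- exact: brauer_scalarD.
- exact/brauer_scalarZ/Hs.
Qed.

Lemma brauer_scalar_prod (s : seq KG) :
  {in s, forall x, brauer_scalar x} -> brauer_scalar (\prod_(x <- s) x).
Proof.
move=> Hs; rewrite big_seq; apply: big_ind => //; first exact: brauer_scalar1.
exact: brauer_scalarM.
Qed.

(** The Brauer image c of e would satisfy c N = 0, where N is the sum over E,
    since u^2 = 0.  A nonzero multiple of c fixed by E is divisible by N, hence
    killed by c, and it is also reproduced by the idempotent c. *)
Lemma brauer_map_no_sandwich (s : seq gT) e lam b :
    2%N \in [pchar K] -> (2.-abelem E)%g -> {subset s <= E} ->
    \prod_(g <- s) augment K g = \sum_(h in E) galg_elt K h ->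
    (forall m : KG, {in s, forall g, galg_elt K g * m = m} ->
                    {in E, forall g, galg_elt K g * m = m}) ->
    central e -> e * e = e -> brauer_map e != 0 ->
  (\prod_(g <- s) augment K g) * e <>
    lin_comb lam (map (@augment K gT) s) * b * lin_comb lam (map (@augment K gT) s).
Proof.
move=> charK abE sE prods fixs ce ee e0.
set xs := map _ s; set u := lin_comb _ _; set c := brauer_map e in e0 *.
have abelE := abelem_abelian abE.
have csz : commuting_square_zero xs := augment_square charK abE sE.
have Bxs : {in xs, forall x, brauer_scalar x}.
  by move=> _ /mapP [g /sE gE ->]; apply: brauer_scalar_augment.
rewrite -(big_map (@augment K gT) predT id) -/xs => /(congr1 brauer_map).
have [ul ur uC] := brauer_scalar_lin_comb lam Bxs.
have [pl _ _] := brauer_scalar_prod Bxs.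
rewrite pl ur ul -mulrA -uC mulrA lin_comb_square // mul0r -/c => Pc.
have cc : c * c = c := brauer_map_idempotent charK (abelem_pgroup abE) ce ee.
have [q [qc0 qx qC]] := fixed_multiple csz e0.
have cq : GRing.comm c q.
  by apply: qC => x /Bxs [_ _ xC]; apply/commr_sym/xC.
have [g gE|d Ed] := @fixed_norm_multiple K gT E (q * c).
  apply: fixs gE => h hs; apply/eqP; rewrite -subr_eq0 -[X in _ - X]mul1r -mulrBl.
  by apply/eqP/qx/map_f.
case/eqP: qc0; rewrite -cq -cc -mulrA cq Ed -prods mulrA.
rewrite -(big_map (@augment K gT) predT id) -/xs.
have -> : c * \prod_(x <- xs) x = 0; last by rewrite mul0r.
have [_ _ pC] := brauer_scalar_prod Bxs.
by rewrite -[LHS]pC.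
Qed.

End Brauer.

Section LoewyBound.
Variables (k : fieldType) (gT : finGroupType) (B : block k gT).
Local Notation K := {fraction {poly k}}.
Local Notation e := (block_idem B).
Local Notation J := (@jacobson (block_algebra B)).

Lemma radical_power_neq0 (E : {group gT}) n :
    2%N \in [pchar k] -> (2.-abelem E)%g -> #|E| = (2 ^ n)%N ->
    (exists2 g, g \in 'C(E)%g & e g != 0) ->
  ideal_exp J n <> [set 0]%classic.
Proof.
move=> chark abE cardE [g gC eg] Jn.
have charK : 2%N \in [pchar K] by apply: (rmorph_pchar (@rat_const k)).
have [[ee ce] _ _] := block_idemP B.
pose eK : group_algebra K gT := galg_map (@rat_const k) e.
have eeK : eK * eK = eK by rewrite /eK -rmorphM ee.
have ceK : central eK.
  apply: galg_commP => h; rewrite /GRing.comm /eK -(galg_map_elt (@rat_const k)).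
  by rewrite -!rmorphM ce.
have [s [szs sE us prods fixs]] := elementary_abelian_basis charK abE cardE.
have uxs : uniq (map (@augment K gT) s).
  rewrite map_inj_uniq // => x y /addIr; exact: galg_elt_inj.
have [|n' x y Jx Fy|y|lam [b]] :=
  @commuting_prod_sandwich K gT charK eK (fun i => scalar_ext (@rat_const k) (ideal_exp J i))
    ceK eeK _ _ (map (@augment K gT) s) (rat_infinite k) uxs (augment_square charK abE sE).
- exact: scalar_ext_one.
- by apply: scalar_ext_mul => //; apply: jacobson_ext.
- by rewrite size_map szs Jn; apply: scalar_ext0.
rewrite big_map; apply: (@brauer_map_no_sandwich K gT E) => //.
apply/eqP => /ffunP /(_ g); rewrite !ffunE gC => /eqP.
by rewrite fmorph_eq0 (negPf eg).
Qed.

Lemma loewy_length_gt (E : {group gT}) n :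
    2%N \in [pchar k] -> (2.-abelem E)%g -> #|E| = (2 ^ n)%N ->
    (exists2 g, g \in 'C(E)%g & e g != 0) ->
  (n < loewy_length (block_algebra B))%N.
Proof.
move=> chark abE cardE eE; rewrite /loewy_length; case: pselect => [ex|]; last first.
  have [m Jm] := jacobson_nilpotent (finite_length_block B).
  by case; exists m; apply/asboolP.
case: ex_minnP => m /asboolP Jm _; rewrite ltnNge; apply/negP => mn.
apply: (radical_power_neq0 chark abE cardE eE).
exact: ideal_exp_eq0_leq (@jacobson_lideal _) mn Jm.
Qed.

End LoewyBound.

(** * Sums over cosets *)

Section CosetSums.
Variables (gT : finGroupType) (V : nmodType).
Implicit Types (Q D : {group gT}) (F : gT -> V).

Definition coset_sum Q D F : V := \sum_(X in lcosets Q D) F (repr X).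

Definition coset_invariant Q F := forall x q, q \in Q -> F (x * q)%g = F x.

Lemma repr_lcoset Q D X : X \in lcosets Q D -> X = (repr X *: Q)%g.
Proof.
by case/lcosetsP=> x _ ->; apply/esym/lcoset_eqP; apply: mem_repr (lcoset_refl Q x).
Qed.

Lemma coset_invariant_eq Q F x y :
  coset_invariant Q F -> (x *: Q = y *: Q)%g -> F x = F y.
Proof.
by move=> QF /lcoset_eqP; rewrite mem_lcoset => yx; rewrite -(mulKVg y x) QF.
Qed.

Lemma coset_sum_translate Q F x : coset_invariant Q F ->
  coset_sum Q [set: gT] (fun y => F (x * y)%g) = coset_sum Q [set: gT] F.
Proof.
move=> QF; rewrite /coset_sum [RHS](reindex_inj (@lcoset_inj _ x)) /=.
apply: eq_big => [X | X XQ].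
  apply/lcosetsP/lcosetsP=> [[y _ ->] | [y _ Xy]].
    by exists (x * y)%g; rewrite ?inE ?lcosetM.
  by exists (x^-1 * y)%g; rewrite ?inE // lcosetM -Xy -lcosetM mulVg lcoset1.
apply: (coset_invariant_eq QF); rewrite lcosetM -(repr_lcoset XQ).
apply: (@repr_lcoset Q [set: gT]%G); apply/lcosetsP; exists (x * repr X)%g; rewrite ?inE //.
by rewrite lcosetM -(repr_lcoset XQ).
Qed.

Lemma coset_sum_trans Q D F : Q \subset D -> coset_invariant Q F ->
  coset_sum Q [set: gT] F =
  coset_sum D [set: gT] (fun x => coset_sum Q D (fun y => F (x * y)%g)).
Proof.
move=> QD QF; rewrite /coset_sum.
rewrite (partition_big (fun X => repr X *: D)%g
  (fun Y => Y \in lcosets D [set: gT])) /=; last first.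
  by move=> X _; apply/lcosetsP; exists (repr X); rewrite ?inE.
apply: eq_bigr => Y YD; set y := repr Y.
have YE : Y = (y *: D)%g := repr_lcoset YD.
have inD x : (x *: D == Y)%g = ((y^-1 * x)%g \in D).
  by rewrite YE -mem_lcoset; apply/eqP/lcoset_eqP.
have inG x : (x *: Q)%g \in lcosets Q [set: gT] by apply/lcosetsP; exists x; rewrite ?inE.
have reprD x : (repr (x *: Q) *: D = x *: D)%g.
  apply/lcoset_eqP; have : repr (x *: Q)%g \in (x *: Q)%g := mem_repr _ (lcoset_refl Q x).
  by apply/fintype.subsetP; rewrite mulgS.
rewrite (reindex_inj (@lcoset_inj _ y)) /=; apply: eq_big => [Z|Z /andP [ZG _]].
  apply/andP/idP => [[/lcosetsP [x _ Zx]]|/lcosetsP [x xD ->]].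
    rewrite Zx reprD inD => xD; apply/lcosetsP; exists (y^-1 * x)%g => //.
    by rewrite lcosetM -Zx -lcosetM mulVg lcoset1.
  by rewrite -lcosetM inG reprD inD mulKg.
have {}ZG : Z \in lcosets Q [set: gT].
  case/lcosetsP: ZG => x _ Zx; apply/lcosetsP; exists (y^-1 * x)%g; rewrite ?inE //.
  by rewrite lcosetM -Zx -lcosetM mulVg lcoset1.
apply: (coset_invariant_eq QF); rewrite lcosetM -(repr_lcoset ZG).
by apply/esym/repr_lcoset; rewrite [Z](repr_lcoset ZG) -lcosetM; apply: inG.
Qed.

Lemma class_coset_sum D F g :
  \sum_(x in (g ^: D)%g) F x = coset_sum 'C_D[g]%G D (fun x => F (g ^ x^-1)%g).
Proof.
have gE x c : c \in 'C_D[g]%g -> (g ^ (x * c)^-1 = g ^ x^-1)%g.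
  case/setIP => _ /cent1P gc; rewrite invMg conjgM; congr (_ ^ _)%g.
  by apply/conjg_fixP/commgP/commuteV.
rewrite /coset_sum -(@big_imset _ _ _ _ _ (fun X => g ^ (repr X)^-1)%g _ F) /=.
  apply: eq_bigl => x; apply/imsetP/imsetP => [[d dD ->]|[X XD ->]].
    exists (d^-1 *: 'C_D[g])%g; first by apply/lcosetsP; exists d^-1%g; rewrite ?groupV.
    have /lcosetP [c cC ->] : repr (d^-1 *: 'C_D[g])%g \in (d^-1 *: 'C_D[g])%g.
      exact: mem_repr (lcoset_refl _ _).
    by rewrite gE // invgK.
  exists (repr X)^-1%g => //; rewrite groupV.
  case/lcosetsP: XD => d dD ->.
  have /lcosetP [c /setIP [cD _] ->] : repr (d *: 'C_D[g])%g \in (d *: 'C_D[g])%g.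
    exact: mem_repr (lcoset_refl _ _).
  exact: groupM.
move=> X Y XD YD E; rewrite [X](repr_lcoset XD) [Y](repr_lcoset YD).
have inD Z : Z \in lcosets 'C_D[g]%G D -> repr Z \in D.
  case/lcosetsP=> d dD ->.
  have /lcosetP [c /setIP [cD _] ->] : repr (d *: 'C_D[g])%g \in (d *: 'C_D[g])%g.
    exact: mem_repr (lcoset_refl _ _).
  exact: groupM.
apply/lcoset_eqP; rewrite mem_lcoset inE groupM ?groupV ?inD //=.
apply/cent1P/commute_sym/commgP/conjg_fixP.
by rewrite conjgM -E -conjgM mulVg conjg1.
Qed.

End CosetSums.

(** * Relative traces and the local centre of a block *)

Section RelativeTrace.
Variables (k : fieldType) (gT : finGroupType).
Local Notation kG := (group_algebra k gT).
Local Notation elt := (@galg_elt k gT).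
Implicit Types (Q D : {group gT}) (a c : kG).

Definition fixed_by Q c := forall q, q \in Q -> GRing.comm c (elt q).

(** The sum of the conjugates of c by coset representatives; it is independent of
    the representatives when c is fixed by Q. *)
Definition rel_trace Q D c : kG := coset_sum Q D (fun x => elt x * c * elt x^-1%g).

Lemma trace_term_invariant Q c : fixed_by Q c ->
  coset_invariant Q (fun x => elt x * c * elt x^-1%g).
Proof.
move=> cQ x q qQ; rewrite invMg !galg_eltM -!mulrA; congr (_ * _).
by rewrite !mulrA -cQ // -[c * _ * _]mulrA -galg_eltM mulgV mulr1.
Qed.

Lemma rel_trace_central Q c : fixed_by Q c -> central (rel_trace Q [set: gT] c).
Proof.
move=> /trace_term_invariant cQ; apply: galg_commP => g.
rewrite /GRing.comm /rel_trace -[in LHS](coset_sum_translate g cQ).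
rewrite /coset_sum mulr_suml mulr_sumr; apply: eq_bigr => X _.
by rewrite invMg !galg_eltM -!mulrA -galg_eltM mulVg mulr1.
Qed.

Lemma rel_trace_mulr Q D c a : central a -> rel_trace Q D c * a = rel_trace Q D (c * a).
Proof.
by move=> ca; rewrite /rel_trace /coset_sum mulr_suml; apply: eq_bigr => X _; rewrite -!mulrA -ca.
Qed.

Lemma rel_traceZ Q D (t : k) c : rel_trace Q D (t *: c) = t *: rel_trace Q D c.
Proof.
rewrite /rel_trace /coset_sum scaler_sumr; apply: eq_bigr => X _.
by rewrite -scalerAr -scalerAl.
Qed.

Lemma rel_trace_sum Q D I (r : seq I) (P : pred I) (F : I -> kG) :
  rel_trace Q D (\sum_(i <- r | P i) F i) = \sum_(i <- r | P i) rel_trace Q D (F i).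
Proof.
rewrite /rel_trace /coset_sum [RHS]exchange_big /=; apply: eq_bigr => X _.
by rewrite mulr_sumr mulr_suml.
Qed.

Lemma rel_trace_trans Q D c a : Q \subset D -> fixed_by D c -> fixed_by Q a ->
  rel_trace D [set: gT] (c * rel_trace Q D a) = rel_trace Q [set: gT] (c * a).
Proof.
move=> QD cD aQ; have caQ : fixed_by Q (c * a).
  move=> q qQ; apply/commr_sym/commrM; apply: commr_sym; last exact: aQ.
  by apply: cD; apply: (fintype.subsetP QD).
rewrite [RHS](coset_sum_trans QD (trace_term_invariant caQ)).
rewrite /rel_trace {1 2}/coset_sum; apply: eq_bigr => X _.
rewrite mulrA mulr_sumr mulr_suml; apply: eq_bigr => Y YD.
have rD : repr Y \in D.
  case/lcosetsP: YD => d dD ->.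
  have /lcosetP [q qQ ->] : repr (d *: Q)%g \in (d *: Q)%g := mem_repr _ (lcoset_refl Q d).
  by rewrite groupM // (fintype.subsetP QD).
rewrite invMg !galg_eltM -!mulrA; congr (_ * _); rewrite !mulrA; congr (_ * _ * _ * _).
exact: cD.
Qed.

Lemma class_sum_trace D g :
  \sum_(x in (g ^: D)%g) elt x = rel_trace 'C_D[g]%G D (elt g).
Proof.
rewrite class_coset_sum; apply: eq_bigr => X _.
by rewrite conjgE invgK !galg_eltM mulrA.
Qed.

(** A central element is constant on D-classes, and each class sum is a relative
    trace from the centraliser of a representative. *)
Lemma central_class_decomposition D a : central a ->
  a = \sum_(O in [set orbit 'J%act D x | x in [set: gT]])
        a (repr O) *: rel_trace 'C_D[repr O]%G D (elt (repr O)).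
Proof.
move=> ca; rewrite [LHS]galg_sumE.
have actD : [acts D, on [set: gT] | 'J] by apply/actsP => h _ x; rewrite !inE.
rewrite (eq_bigl (fun x => x \in [set: gT])) => [|x]; last by rewrite inE.
rewrite (set_partition_big _ (orbit_partition actD)) /=.
apply: eq_bigr => O /imsetP [x _ OE].
have xO : x \in O by rewrite OE orbit_refl.
have {}OE : O = (repr O ^: D)%g.
  rewrite {1}OE; have : repr O \in (x ^: D)%g by rewrite -orbitJ -OE (mem_repr x).
  by rewrite orbitJ => /class_eqP.
rewrite -class_sum_trace -OE scaler_sumr; apply: eq_bigr => y.
by rewrite {1}OE => /imsetP [h _ ->]; rewrite central_conj.
Qed.

End RelativeTrace.

Section LocalCentre.
Variables (k : fieldType) (gT : finGroupType) (B : block k gT).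
Local Notation kG := (group_algebra k gT).
Local Notation e := (block_idem B).
Implicit Types (a b z : kG).

Definition block_unit z := exists2 a, central a & z * a = e.

Lemma centralM a b : central a -> central b -> central (a * b).
Proof. by move=> ca cb x; rewrite -mulrA cb mulrA ca -mulrA. Qed.

Lemma centralB a b : central a -> central b -> central (a - b).
Proof. by move=> ca cb x; rewrite mulrBl mulrBr ca cb. Qed.

Lemma centralX a n : central a -> central (a ^+ n).
Proof.
move=> ca; elim: n => [|n IH]; first by move=> x; rewrite mul1r mulr1.
by rewrite exprS; apply: centralM.
Qed.

(** The idempotent p = y m with m = z^(n+1) is central although the y of [fitting]
    need not be: m kills the commutator of p with any x, hence so does p, on
    either side.  As e is primitive, pe is either 0 or e. *)
Lemma block_unit_or_nil z : central z -> block_unit z \/ exists n, z ^+ n * e = 0.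
Proof.
move=> cz; have [[ee ce] e0 prim] := block_idemP B.
have [n [y Ey]] := fitting (finite_length_galg k gT) z.
set m := z ^+ n.+1 in Ey; have cm : central m by apply: centralX.
pose p := y * m.
have mp : m * p = m by rewrite /p mulrA cm -mulrA -Ey.
have pp : p * p = p by rewrite {1}/p -mulrA mp.
(* The commutator d = px - xp satisfies md = 0, hence pd = 0 and dp = 0, which say
   that px = pxp and pxp = xp. *)
have cp : central p.
  have killed d : m * d = 0 -> p * d = 0 by move=> md; rewrite /p -mulrA md mulr0.
  have killed' d : m * d = 0 -> d * p = 0.
    by move=> md; rewrite /p mulrA -cm mulrA md mul0r.
  move=> x; have md : m * (p * x - x * p) = 0.
    by rewrite mulrBr mulrA mp [m * (x * p)]mulrA cm -mulrA mp subrr.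
  have /eqP := killed _ md; rewrite mulrBr mulrA pp subr_eq0 => /eqP ->.
  by have /eqP := killed' _ md; rewrite mulrBl -[x * p * p]mulrA pp subr_eq0 -mulrA => /eqP.
have cpe : central (p * e) := centralM cp ce.
have idpe : (p * e) * (p * e) = p * e by rewrite mulrA -[p * e * p]mulrA ce mulrA pp -mulrA ee.
have [||||pe0|pe1] := prim (p * e) (e - p * e).
- by [].
- split; last exact: centralB.
  by rewrite mulrBl !mulrBr ee idpe ce -mulrA ee subrr subr0.
- by rewrite mulrBr idpe -mulrA ee subrr.
- by rewrite addrC subrK.
- by right; exists n.+1; rewrite -/m -mp -mulrA pe0 mulr0.
have [a [za ae]] : exists a, z * a = e /\ a * e = a.
  exists (y * z ^+ n * e); split; last by rewrite -[LHS]mulrA ee.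
  have -> : z * (y * z ^+ n * e) = p * e by rewrite !mulrA cz -[y * z * _]mulrA -exprS.
  by apply/esym/eqP; rewrite -subr_eq0 pe1.
left; exists a => // x; rewrite -[in LHS]ae -mulrA ce -{1}za [x * (z * a)]mulrA -cz.
by rewrite !mulrA -[a * z]cz za ce -mulrA ce ae.
Qed.

(** The centre of a block is local: nonunits are closed under addition, for if
    (z + z')a = e and za is nilpotent, a geometric series inverts z'a = e - za. *)
Lemma block_unit_sum I (r : seq I) (P : pred I) (F : I -> kG) :
  (forall i, P i -> central (F i)) -> \sum_(i <- r | P i) F i = e ->
  exists2 i, P i & block_unit (F i).
Proof.
move=> cF sumF; have [[ee ce] e0 _] := block_idemP B.
apply: contrapT => noP; pose N z := central z /\ ~ block_unit z.
have : N (\sum_(i <- r | P i) F i); last first.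
  by rewrite sumF => -[_]; apply; exists e.
apply: big_ind => [|z z' [cz Nz] [cz' Nz']|i Pi]; last first.
- by split; [apply: cF|move=> Ui; apply: noP; exists i].
- split=> [x|[a ca zza]]; first by rewrite mulrDl mulrDr cz cz'.
  have [[b cb zab]|[n zan]] := block_unit_or_nil (centralM cz ca).
    by apply: Nz; exists (a * b); [apply: centralM|rewrite mulrA].
  apply: Nz'; exists (a * ((\sum_(j < n) (z * a) ^+ j) * e)).
    apply: centralM => //; apply: centralM => // x.
    rewrite mulr_suml mulr_sumr; apply: eq_bigr => j _.
    by have := centralX j (centralM cz ca) x.
  have z'a : z' * a = e - z * a by rewrite -zza mulrDl addrC addKr.
  set S := \sum_(j < n) _; set t := z * a in z'a zan S *.
  have St : t * (S * e) = S * e - e.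
    have : (t - 1) * S * e = - e by rewrite -subrX1 mulrBl zan mul1r sub0r.
    by rewrite !mulrBl mul1r -mulrA => <-; rewrite addrC subrK.
  by rewrite mulrA z'a mulrBl St ce -mulrA ee opprB addrC subrK.
split=> [x|[a ca]]; first by rewrite mul0r mulr0.
by rewrite mul0r => /esym/eqP; rewrite (negPf e0).
Qed.

End LocalCentre.

(** * Higman's criterion and the coefficients of a block idempotent *)

Section RegularModule.
Variables (k : fieldType) (gT : finGroupType) (B : block k gT).
Local Notation kG := (group_algebra k gT).
Local Notation e := (block_idem B).

(** The block as a left module over kG, under a name of its own because the
    block algebra already carries scalars from k. *)
Definition regular_module : Type := block_algebra B.

HB.instance Definition _ := GRing.Zmodule.on regular_module.

Lemma in_blockMl (a : kG) (x : block_algebra B) : a * \val x \in in_block B.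
Proof. by rewrite unfold_in -mulrA (eqP (valP x)). Qed.

Definition regular_scale (a : kG) (x : regular_module) : regular_module :=
  BlockElt (in_blockMl a x).

Lemma regular_scaleA a b x : regular_scale a (regular_scale b x) = regular_scale (a * b) x.
Proof. by apply/val_inj; rewrite /= mulrA. Qed.

Lemma regular_scale1 : left_id 1 regular_scale.
Proof. by move=> x; apply/val_inj; rewrite /= mul1r. Qed.

Lemma regular_scaleDr : right_distributive regular_scale +%R.
Proof. by move=> a x y; apply/val_inj; rewrite /= mulrDr. Qed.

Lemma regular_scaleDl x : {morph regular_scale^~ x : a b / a + b}.
Proof. by move=> a b; apply/val_inj; rewrite /= mulrDl. Qed.

HB.instance Definition _ := GRing.Zmodule_isLmodule.Build kG regular_module
  regular_scaleA regular_scale1 regular_scaleDr regular_scaleDl.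

Definition right_mul (b x : regular_module) : regular_module := block_mul x b.

Lemma right_mul_linear b : linear (right_mul b).
Proof. by move=> a x y; apply/val_inj; rewrite /= mulrDl mulrA. Qed.

HB.instance Definition _ b :=
  GRing.isLinear.Build kG regular_module regular_module _ (right_mul b) (right_mul_linear b).

Definition regular_one : regular_module := block_one B.

Lemma regular_fg : finitely_generated regular_module.
Proof.
exists 1%N, (fun=> regular_one) => m; exists (fun=> \val m); rewrite big_ord1.
by apply/val_inj; rewrite /= (eqP (valP m)).
Qed.

Lemma regular_unit (m : regular_module) : e *: m = m.
Proof.
by apply/val_inj; case: (block_idemP B) => -[_ ce] _ _; rewrite /= ce (eqP (valP m)).
Qed.

Definition regular_block_mod : block_mod B := BlockMod regular_fg regular_unit.

End RegularModule.

Section InducedExpansion.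
Variables (k : fieldType) (gT : finGroupType) (D : {group gT}).
Variable N : lmodType (group_algebra k (subg_of D)).

Lemma induced_expansion (f : indmod N) :
  f = \sum_(X in lcosets D [set: gT]) galg_elt k (repr X) *:
        (ind_unit (\val f (repr X)) : indmod N).
Proof.
apply/val_inj/ffunP=> g; rewrite raddf_sum sum_ffunE.
under eq_bigr do rewrite ind_scale_elt /= ffunE.
have gD : (g *: D)%g \in lcosets D [set: gT] by apply/lcosetsP; exists g; rewrite ?inE.
rewrite (bigD1 (g *: D)%g) //= big1 ?addr0 => [|X /andP[XD neX]].
  have rD : ((repr (g *: D))^-1 * g)%g \in D.
    by rewrite -mem_lcoset -(repr_lcoset gD) lcoset_refl.
  rewrite rD -(is_equivariantP _ (valP f)); congr (\val f _).
  by rewrite /= subgK // mulKVg.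
case: ifP => // rD; case/eqP: neX; rewrite [X](repr_lcoset XD).
by apply/esym/lcoset_eqP; rewrite mem_lcoset.
Qed.

Lemma ind_map_unit (N' : lmodType (group_algebra k (subg_of D))) (phi : {linear N -> N'}) n :
  ind_map phi (ind_unit n) = ind_unit (phi n).
Proof.
apply/val_inj/ffunP=> g; rewrite !ffunE /=; case: ifP => _; first by rewrite linearZ.
by rewrite linear0.
Qed.

End InducedExpansion.

Section Higman.
Variables (k : fieldType) (gT : finGroupType) (B : block k gT).
Local Notation kG := (group_algebra k gT).
Local Notation elt := (@galg_elt k gT).
Local Notation e := (block_idem B).
Implicit Type D : {group gT}.

(** Apply the two transformations to the block itself.  Its endomorphisms are the
    right multiplications, and naturality with respect to them shows that the
    image of 1 under eta is g |-> F(1) g^-1 and that eps is determined by the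
    element C to which it sends 1.  Then eps (eta 1) = 1 says that e is the trace
    of C F(1). *)
Lemma id_summand_trace D : id_summand_ind_res B D ->
  exists2 c, fixed_by D c & rel_trace D [set: gT] c = e.
Proof.
move=> [eta [eps [eta_nat eps_nat etaK]]].
pose M := regular_block_mod B; pose one : M := regular_one B.
pose f := eta M one; pose psi (m : resmod D M) : M := eps M (ind_unit m).
have [[ee ce] _ _] := block_idemP B.
pose F g : kG := block_val (\val f g).
have Fe g : F g * e = F g by apply/eqP/(valP (\val f g : block_algebra B)).
(* Right multiplication by g^-1 e and left multiplication by g^-1 agree on 1. *)
have FE g : F g = F 1%g * elt g^-1%g.
  pose b : M := elt g^-1%g *: one.
  have : elt g^-1%g *: f = ind_map (res_map D (right_mul b)) f.
    rewrite /f -linearZ -(eta_nat M M (right_mul b)); congr (eta M _).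
    by apply/val_inj; rewrite /= mulrA ce -!mulrA ee.
  move/(congr1 (fun h : indmod (resmod D M) => block_val (\val h 1%g))).
  rewrite ind_scale_elt invgK mulg1 ffunE /= -/(F g) => ->.
  by rewrite -[LHS]/(F 1%g * (elt g^-1%g * e)) -ce mulrA Fe.
have F1 : fixed_by D (F 1%g).
  move=> d dD; rewrite /GRing.comm -[d in LHS]invgK -FE.
  have /(congr1 (@block_val k gT B)) := is_equivariantP _ (valP f) 1%g (subg D d^-1%g).
  rewrite mul1g [val (subg D _)]/= subgK ?groupV // res_scaleE galg_incl_elt /= => E.
  by rewrite [LHS]E subgK ?groupV // invgK.
pose C : kG := block_val (psi one).
have Ce : C * e = C by apply/eqP/(valP (psi one : block_algebra B)).
(* Right multiplication by m sends 1 to m. *)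
have psiE (m : M) : block_val (psi m) = C * block_val m.
  have := eps_nat M M (right_mul m) (ind_unit (one : resmod D M)).
  rewrite (ind_map_unit (res_map D (right_mul m))).
  rewrite [X in eps M (ind_unit X)](_ : _ = m); last first.
    by apply/val_inj; rewrite /= ce (eqP (valP (m : block_algebra B))).
  by move/(congr1 (@block_val k gT B)).
have CD : fixed_by D C.
  move=> d dD.
  have : psi (galg_elt k (subg D d) *: (one : resmod D M)) = elt d *: psi one.
    by rewrite /psi linearZ linearZ /= galg_incl_elt /= subgK.
  move/(congr1 (@block_val k gT B)); rewrite psiE.
  rewrite res_scaleE galg_incl_elt /= subgK // => E.
  by rewrite /GRing.comm -[RHS]E -ce mulrA Ce.
exists (C * F 1%g).
  by move=> d dD; apply/commr_sym/commrM; apply: commr_sym; [apply: CD|apply: F1].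
have := congr1 (@block_val k gT B) (etaK M one).
rewrite -/f [f]induced_expansion linear_sum /= => <-.
have valD : {morph (@block_val k gT B : M -> kG) : x y / x + y >-> x + y} by [].
have val0 : block_val (0 : M) = 0 by [].
rewrite (big_morph _ valD val0).
apply: eq_bigr => X _; rewrite linearZ /=.
by rewrite -!mulrA -FE -psiE.
Qed.

End Higman.

Section TraceSplitting.
Variables (k : fieldType) (gT : finGroupType) (D : {group gT}).
Local Notation kG := (group_algebra k gT).
Local Notation elt := (@galg_elt k gT).

Section Maps.
Variable M : lmodType kG.

Definition fixed_act (c : kG) (cD : fixed_by D c) (n : resmod D M) : resmod D M :=
  c *: (n : M).

Lemma fixed_act_linear c (cD : fixed_by D c) : linear (fixed_act cD).
Proof.
move=> a m n; rewrite /fixed_act res_scaleE scalerDr scalerA.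
rewrite res_scaleE scalerA; congr (_ *: (_ : M) + _).
rewrite /galg_incl mulr_sumr mulr_suml; apply: eq_bigr => d _.
by rewrite -scalerAr -scalerAl cD // subgP.
Qed.

HB.instance Definition _ c (cD : fixed_by D c) := GRing.isLinear.Build
  (group_algebra k (subg_of D)) (resmod D M) (resmod D M) _ (fixed_act cD) (fixed_act_linear cD).

Definition diagonal_fun (m : M) : {ffun gT -> resmod D M} := [ffun g => elt g^-1%g *: m].

Lemma diagonal_equivariant m : diagonal_fun m \in @is_equivariant _ _ D (resmod D M).
Proof.
apply/is_equivariantP=> g d.
by rewrite !ffunE res_scaleE galg_incl_elt scalerA -galg_eltM invMg.
Qed.

Definition diagonal m : indmod (resmod D M) := IndElt (diagonal_equivariant m).

Lemma galg_incl_scalar (t : k) : galg_incl (t%:A : group_algebra k (subg_of D)) = t%:A.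
Proof. by rewrite linearZ rmorph1. Qed.

Lemma diagonal_linear : linear diagonal.
Proof.
move=> a m n; apply/val_inj/ffunP=> g; rewrite !ffunE scalerDr; congr (_ + _).
rewrite scalerA [in LHS](galg_sumE a) mulr_sumr scaler_suml; apply: eq_bigr => x _.
rewrite ffunE res_scaleE galg_incl_scalar scalerA -scalerAl mul1r -scalerAr -galg_eltM.
by rewrite invMg invgK.
Qed.

HB.instance Definition _ :=
  GRing.isLinear.Build kG M (indmod (resmod D M)) _ diagonal diagonal_linear.

End Maps.

(** The splitting sends m to g |-> g^-1 m, and the retraction is induced by the
    action of c on the restricted module; the composite is the action of the trace
    of c. *)
Lemma trace_id_summand (B : block k gT) c : fixed_by D c ->
  rel_trace D [set: gT] c = block_idem B -> id_summand_ind_res B D.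
Proof.
move=> cD ce.
pose ext (M : block_mod B) := cid (ind_universal (fixed_act (M := M) cD)).
pose eps (M : block_mod B) := sval (ext M).
have epsP M := svalP (ext M).
exists (fun M : block_mod B => @diagonal M), eps; split.
- move=> M M' phi m; apply/val_inj/ffunP=> g; rewrite !ffunE.
  by rewrite /res_map -linearZ.
- move=> M M' phi f; rewrite [f]induced_expansion 4!linear_sum; apply: eq_bigr => X _.
  rewrite 4!linearZ /=; congr (_ *: _).
  have [epsM _] := epsP M; have [epsM' _] := epsP M'.
  by rewrite ind_map_unit epsM' epsM /fixed_act /res_map linearZ.
- move=> M m; have [epsM _] := epsP M.
  rewrite -[RHS]block_mod_unit -ce scaler_suml [X in eps M X]induced_expansion linear_sum.
  by apply: eq_bigr => X _; rewrite linearZ /= epsM /fixed_act ffunE !scalerA.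
Qed.

End TraceSplitting.

(** The trace formula e = Tr(c) and the decomposition of e into D-classes give
    e = e Tr(c) = Tr(ce) as a sum of traces from centralisers in D. *)
Lemma defect_group_brauer (k : fieldType) (gT : finGroupType) (B : block k gT)
    (D : {group gT}) : defect_group B D -> exists2 g, g \in 'C(D)%g & block_idem B g != 0.
Proof.
move=> [sumD minD]; have [c cD ce] := id_summand_trace sumD.
have [[ee eC] e0 _] := block_idemP B; set e := block_idem B in ce ee eC e0 *.
pose P := [set orbit 'J%act D x | x in [set: gT]].
pose Q (O : {set gT}) := 'C_D[repr O]%G.
pose z O : group_algebra k gT := e (repr O) *: rel_trace (Q O) [set: gT] (c * galg_elt k (repr O)).
have gQ O : fixed_by (Q O) (galg_elt k (repr O)).
  by move=> q /setIP [_ /cent1P qO]; rewrite /GRing.comm -!galg_eltM qO.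
have cgQ O : fixed_by (Q O) (c * galg_elt k (repr O)).
  move=> q qQ; apply/commr_sym/commrM; apply: commr_sym; last exact: gQ.
  by apply: cD; case/setIP: qQ.
have QsubD O : Q O \subset D by apply: subsetIl.
have ze : \sum_(O in P) z O = e.
  rewrite -[RHS]ee -[in X in X * _]ce rel_trace_mulr // {1}(central_class_decomposition D eC).
  rewrite mulr_sumr rel_trace_sum; apply: eq_bigr => O _.
  by rewrite -scalerAr rel_traceZ (rel_trace_trans (QsubD O) cD (gQ O)).
have [|O _ [a ca za]] := @block_unit_sum k gT B _ _ _ z _ ze.
  by move=> O _; rewrite /z -rel_traceZ; apply: rel_trace_central => q qQ;
    rewrite /GRing.comm -scalerAl -scalerAr cgQ.
have QD : Q O :=: D.
  apply: minD; last exact: QsubD.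
  apply: (@trace_id_summand _ _ _ B (e (repr O) *: (c * galg_elt k (repr O)) * a)).
    move=> q qQ; apply/commr_sym/commrM; apply: commr_sym; last exact: ca.
    by rewrite /GRing.comm -scalerAl -scalerAr cgQ.
  by rewrite -rel_trace_mulr // rel_traceZ.
exists (repr O); last first.
  apply/eqP => eO; case/eqP: e0; rewrite /e -za /z eO scale0r mul0r //.
by rewrite -sub_cent1 -QD subsetIr.
Qed.

(** * The bound *)

Local Close Scope ring_scope.

Theorem theorem8p17 (gT : finGroupType) (k : fieldType)
    (char_k : 2%N \in [pchar k]%R)
    (B : block k gT) (D : {group gT}) (defD : defect_group B D) :
  (loewy_length (block_algebra B) > 'r_2(D)%g)%N.
Proof.
have [g gD eg] := defect_group_brauer defD.
have [E rE] := p_rank_witness 2 D.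
have cardE := card_pnElem rE; have [ED abE _] := pnElemP rE.
apply: (loewy_length_gt char_k abE cardE); exists g => //.
exact: (fintype.subsetP (centS ED)).
Qed.
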